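(* Let $(\lambda_n)_{n\ge 1}$ be a sequence of non-zero complex numbers with $|\lambda_n|\to+\infty$ satisfying the following condition: for every $M>0$ there exists a subsequence $(\mu_n)_{n\ge1}$ of $(\lambda_n)$ such that (i) $|\mu_{n+1}|-|\mu_n|>M$ for every $n=1,2,\ldots$, and (ii) $\limsup_{n\to+\infty}\Big(|\mu_n|\cdot\sum_{k=n}^{+\infty}\frac{1}{|\mu_k|}\Big)=+\infty$. Then for every $r\in(0,+\infty)$ the set $\bigcap_{a\in C_r}HC(\{T_{\lambda_n a}\})$, where $C_r=\{z\in\mathbb{C}:|z|=r\}$, is a $G_\delta$ and dense subset of $(\mathcal{H}(\mathbb{C}),\mathcal{T}_u)$. In particular, $\bigcap_{a\in C_r}HC(\{T_{\lambda_n a}\})\neq\emptyset$.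
   Context: $\mathcal{H}(\mathbb{C})$ is the space of entire functions and $\mathcal{T}_u$ is the topology of local uniform convergence (uniform convergence on compact sets) on it. For a non-zero $b\in\mathbb{C}$, the translation operator $T_b:\mathcal{H}(\mathbb{C})\to\mathcal{H}(\mathbb{C})$ is $T_b(f)(z)=f(z+b)$. For a sequence $(T_n)$ of continuous linear operators on a topological vector space $X$, $HC(\{T_n\})$ is the set of all $x\in X$ such that $\{T_n(x):n=1,2,\ldots\}$ is dense in $X$. Thus $HC(\{T_{\lambda_n a}\})$ is the set of $f\in\mathcal{H}(\mathbb{C})$ such that the set of functions $\{f(\cdot+\lambda_n a):n=1,2,\ldots\}$ is dense in $(\mathcal{H}(\mathbb{C}),\mathcal{T}_u)$. A set is $G_\delta$ if it is a countable intersection of open sets. In (ii), a divergent series of positive terms has the value $+\infty$. *)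

(* Defs.v *)
From HB Require Import structures.
From mathcomp Require Import all_boot all_order all_algebra.
From mathcomp Require Import complex.
From mathcomp Require Import all_classical all_reals all_analysis borel_hierarchy.

Set Implicit Arguments.
Unset Strict Implicit.
Unset Printing Implicit Defensive.

Import Order.TTheory GRing.Theory Num.Theory.
Import numFieldNormedType.Exports.

Local Open Scope classical_set_scope.
Local Open Scope ring_scope.
Local Open Scope complex_scope.

(* [R[i]^o] is the complex plane as a normed module over itself, so that
   [derivable f z 1] is complex differentiability at [z]. On [R[i]] the norm
   [`|z|] takes its values in [R[i]]; the real-valued modulus is [normc]. *)
Notation normc := ComplexField.Normc.normc.

(* [{family compact, U -> V}] carries the topology of uniform convergence on
   compact sets. *)
Definition entire (R : realType) : set {family compact, R[i]^o -> R[i]^o} :=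
  [set f | forall z : R[i]^o, derivable (f : R[i]^o -> R[i]^o) z 1].
Arguments entire R : clear implicits.

(* As the type of a subset, it has the subspace topology. *)
Notation entire_space R := (set_type (entire R)).

Lemma entire_translate (R : realType) (b : R[i]) (f : entire_space R) :
  entire R (fun z : R[i]^o => (set_val f : R[i]^o -> R[i]^o) (z + b)).
Proof.
move=> z; have := set_valP f (z + b); rewrite /derivable.
by under eq_fun => h do rewrite /= addrA.
Qed.

Definition translation (R : realType) (b : R[i]) (f : entire_space R) :
  entire_space R := SigSub (mem_set (@entire_translate R b f)).

(* The hypercyclic elements of the sequence of operators [T]. *)
Definition HC (X : topologicalType) (T : nat -> X -> X) : set X :=
  [set x | dense (range (fun n => T n x))].

Definition circle (R : realType) (r : R) : set R[i] := [set z | normc z = r].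

(* Main.v *)
(* The functions in the intersection form a countable intersection of open sets, one
   for each member of a countable dense family of targets p, each radius k and each
   precision; by a Baire argument it is enough to approximate any entire f, uniformly
   on a given disc, by an entire F such that for every a on the circle some translate
   F(. + lambda_n a) is close to p on |z| <= k.

   Choose a subsequence mu_n with large gaps. F is built circle after circle: on the
   circle of radius r |mu_n| one places about |mu_n| equally spaced discs of fixed
   radius and makes F close to the corresponding translates of p on all of them,
   changing it little inside. A disc with centre mu_n a serves all directions within
   const / |mu_n| of a, so successive circles, rotated suitably, fill the angle of
   order 1 / |mu_n0| between consecutive centres on the first one as soon as
   |mu_n0| (1 / |mu_n0| + ... + 1 / |mu_n|) is large, which (ii) provides.

   The Runge-type approximation on such a ring is explicit: N equally spaced discs
   on a circle all lie where (z / c)^N is close to 1, the inner disc lies where it is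
   close to 0, and iterating polynomials with superattracting fixed points turns
   this into a cut-off function and into the locally constant function sending z
   to the nearest centre. Completeness of the space of entire functions rests on
   Cauchy's estimate, derived from a discrete form of Goursat's lemma. *)
Require Import Defs.
From HB Require Import structures.
From mathcomp Require Import all_boot all_order all_algebra.
From mathcomp Require Import complex.
From mathcomp Require Import all_classical all_reals all_analysis borel_hierarchy.
From mathcomp Require Import ring lra.

Set Implicit Arguments.
Unset Strict Implicit.
Unset Printing Implicit Defensive.

Import Order.TTheory GRing.Theory Num.Theory.
Import numFieldNormedType.Exports.
Import ComplexField.Normc.

Local Open Scope classical_set_scope.
Local Open Scope ring_scope.
Local Open Scope complex_scope.

(** * The real-valued modulus on the complex numbers *)

Section ComplexModulus.
Variable R : realType.
Implicit Types (x y z w : R[i]) (a b : R).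

Lemma normcB_le x y : normc (x - y) <= normc x + normc y.
Proof. by rewrite -[normc y]normcN le_normcD. Qed.

Lemma normc_distC x y : normc (x - y) = normc (y - x).
Proof. by rewrite -normcN opprB. Qed.

Lemma normc_dist_triangle z x y : normc (x - y) <= normc (x - z) + normc (z - y).
Proof. by rewrite -[x - y](subrKA z) le_normcD. Qed.

Lemma normc_ge0 x : 0 <= normc x.
Proof. by case: x => a b; exact: sqrtr_ge0. Qed.

Lemma normc_eq0 x : (normc x == 0) = (x == 0).
Proof.
apply/eqP/eqP => [|->]; [exact: eq0_normc|exact: normc0].
Qed.

Lemma normc_gt0 x : (0 < normc x) = (x != 0).
Proof. by rewrite lt_neqAle normc_ge0 andbT eq_sym normc_eq0. Qed.

Lemma normc_real a : normc a%:C = `|a|.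
Proof. by rewrite /= expr0n /= addr0 sqrtr_sqr. Qed.

Lemma normc_i : normc ('i : R[i]) = 1.
Proof. by rewrite /= expr0n /= add0r expr1n sqrtr1. Qed.

Lemma normc_exp x n : normc (x ^+ n) = normc x ^+ n.
Proof.
by elim: n => [|n IHn]; rewrite ?expr0 ?normc1// !exprS normcM IHn.
Qed.

Lemma normc_natr n : normc (n%:R : R[i]) = n%:R.
Proof. by rewrite -(rmorph_nat (real_complex R)) normc_real ger0_norm. Qed.

Lemma normc_sum (I : Type) (s : seq I) (P : pred I) (F : I -> R[i]) :
  normc (\sum_(i <- s | P i) F i) <= \sum_(i <- s | P i) normc (F i).
Proof.
elim/big_rec2: _ => [|i a x _ le_xa]; first by rewrite normc0.
by apply: le_trans (le_normcD _ _) _; rewrite lerD2l.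
Qed.

Lemma Re_le_normc x : `|complex.Re x| <= normc x.
Proof.
case: x => a b /=; rewrite -sqrtr_sqr ler_sqrt ?addr_ge0 ?sqr_ge0//.
by rewrite lerDl sqr_ge0.
Qed.

Lemma Im_le_normc x : `|complex.Im x| <= normc x.
Proof.
case: x => a b /=; rewrite -sqrtr_sqr ler_sqrt ?addr_ge0 ?sqr_ge0//.
by rewrite lerDr sqr_ge0.
Qed.

Lemma normc_le_ReIm x : normc x <= `|complex.Re x| + `|complex.Im x|.
Proof.
rewrite {1}[x]complexE -[`|complex.Re x|]normc_real -[`|complex.Im x|]normc_real.
by apply: le_trans (le_normcD _ _) _; rewrite normcM normc_i mul1r.
Qed.

End ComplexModulus.

(** * Sequences with geometrically small increments *)

Lemma geometric_small (R : realType) (c e : R) : 0 < e -> exists k, c / 2 ^+ k < e.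
Proof.
move=> e0; have [c0|c0] := leP c 0.
  by exists 0; rewrite expr0 divr1; exact: le_lt_trans e0.
have [k _ /(_ k (leqnn k))] := near_infty_natSinv_expn_lt (PosNum (divr_gt0 e0 c0)).
move=> /= klt; exists k; rewrite -ltr_pdivlMl//.
by move: klt; rewrite mul1r [c^-1 * _]mulrC.
Qed.

Lemma halving_le (R : realType) (e : nat -> R) : (forall k, e k.+1 <= e k / 2) ->
  forall k, e k <= e 0 / 2 ^+ k.
Proof.
move=> e_half; elim=> [|k IHk]; first by rewrite expr0 divr1.
by rewrite exprSr invfM mulrA; apply: le_trans (e_half k) _; rewrite ler_wpM2r.
Qed.

(** The increments from [k] on add up to at most [2 * c / 2 ^+ k], so the intervals of this radius
    around [u k] are nested; the supremum of their left ends lies in all of them. *)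
Lemma geometric_cauchy_limit (R : realType) (u : nat -> R) (c : R) :
    (forall k, `|u k.+1 - u k| <= c / 2 ^+ k) ->
  exists l, forall k, `|u k - l| <= 2 * c / 2 ^+ k.
Proof.
move=> u_step.
have c_half k : 2 * c / 2 ^+ k.+1 = c / 2 ^+ k :> R.
  by rewrite exprS; field; rewrite expf_neq0.
have c_ge0 : 0 <= c.
  by have := le_trans (normr_ge0 _) (u_step 0); rewrite expr0 divr1.
have e_ge0 k : 0 <= 2 * c / 2 ^+ k by rewrite divr_ge0 ?mulr_ge0 ?exprn_ge0.
pose lo k := u k - 2 * c / 2 ^+ k; pose hi k := u k + 2 * c / 2 ^+ k.
have lo_step k : lo k <= lo k.+1.
  have := u_step k; rewrite ler_norml => /andP[u1 u2].
  have : 2 * c / 2 ^+ k = 2 * (c / 2 ^+ k) by rewrite mulrA.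
  rewrite /lo c_half; lra.
have hi_step k : hi k.+1 <= hi k.
  have := u_step k; rewrite ler_norml => /andP[u1 u2].
  have : 2 * c / 2 ^+ k = 2 * (c / 2 ^+ k) by rewrite mulrA.
  rewrite /hi c_half; lra.
have lo_mono : {homo lo : i j / (i <= j)%N >-> i <= j}.
  exact: (homo_leq le_refl (@le_trans _ _)).
have hi_mono i j : (i <= j)%N -> hi j <= hi i.
  elim: j => [|j IHj]; first by rewrite leqn0 => /eqP->.
  by rewrite leq_eqVlt => /orP[/eqP->//|/IHj/(le_trans (hi_step j))].
have lohi i j : lo i <= hi j.
  have [ij|/ltnW ji] := leqP i j.
    by apply: le_trans (lo_mono _ _ ij) _; rewrite /lo /hi; have := e_ge0 j; lra.
  by apply: le_trans (hi_mono _ _ ji); rewrite /lo /hi; have := e_ge0 i; lra.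
pose A := range lo.
have supA : has_sup A.
  by split; [exists (lo 0); exists 0|exists (hi 0) => _ [i _ <-]].
exists (sup A) => k; rewrite distrC ler_norml; apply/andP; split.
  rewrite lerBrDr addrC; apply: ub_le_sup; first by case: supA.
  by exists k.
rewrite lerBlDl; apply: ge_sup => [|_ [i _ <-]]; first by case: supA.
by rewrite addrC; have := lohi i k; rewrite /hi addrC.
Qed.

Lemma geometric_cauchy_limitC (R : realType) (u : nat -> R[i]) (c : R) :
    (forall k, normc (u k.+1 - u k) <= c / 2 ^+ k) ->
  exists l, forall k, normc (u k - l) <= 4 * c / 2 ^+ k.
Proof.
move=> u_step.
have [|a la] := @geometric_cauchy_limit R (fun k => complex.Re (u k)) c.
  by move=> k; apply: le_trans (u_step k); rewrite -raddfB Re_le_normc.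
have [|b lb] := @geometric_cauchy_limit R (fun k => complex.Im (u k)) c.
  by move=> k; apply: le_trans (u_step k); rewrite -raddfB Im_le_normc.
exists (a +i* b) => k; apply: le_trans (normc_le_ReIm _) _.
have := la k; have := lb k; rewrite !raddfB/=.
have -> : 4 * c / 2 ^+ k = 2 * c / 2 ^+ k + 2 * c / 2 ^+ k by ring.
lra.
Qed.

(** * A discrete Goursat lemma for squares *)

Section Goursat.
Variable R : realType.
Implicit Types (f phi : R[i] -> R[i]) (z v d : R[i]).

(** The difference quotient is multiplied out by [normc h], so that [h = 0] is allowed and all
    estimates take place in [R]. *)
Definition cderiv f z d := forall e : R, 0 < e -> exists2 del, 0 < del &
  forall h, normc h < del -> normc (f (z + h) - f z - d * h) <= e * normc h.

(* The four edges are sampled at corresponding nodes, so that [square_sum] vanishes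
   exactly on affine functions and is exactly additive under bisection: the proof
   of Goursat's lemma then needs no integral. *)
Definition edge_sum phi n z v : R[i] :=
  (\sum_(j < 2 ^ n) phi (z + v * (j%:R / 2 ^+ n))) * (v / 2 ^+ n).

Definition square_sum phi n z v : R[i] :=
  edge_sum phi n z v + edge_sum phi n (z + v) ('i * v)
  - edge_sum phi n (z + 'i * v) v - edge_sum phi n z ('i * v).

Lemma edge_sum_halve phi n z v : edge_sum phi n.+1 z v =
  edge_sum phi n z (v / 2) + edge_sum phi n (z + v / 2) (v / 2).
Proof.
have n2 : (2 ^+ n : R[i]) != 0 by rewrite expf_neq0.
rewrite /edge_sum -mulrDl; have -> : v / 2 / 2 ^+ n = v / 2 ^+ n.+1.
  by rewrite exprS; field.
congr (_ * _); rewrite expnS mul2n -addnn big_split_ord /=.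
congr (_ + _); apply: eq_bigr => j _; congr (phi _).
  by rewrite exprS; field.
have -> : ((2 ^ n + j)%:R : R[i]) = 2 ^+ n + j%:R by rewrite natrD natrX.
by rewrite exprS; field.
Qed.

(** Each inner edge of the four quarters occurs twice, with opposite signs. *)
Lemma square_sum_split phi n z v : square_sum phi n.+1 z v =
  square_sum phi n z (v / 2) + square_sum phi n (z + v / 2) (v / 2)
  + square_sum phi n (z + 'i * (v / 2)) (v / 2)
  + square_sum phi n (z + v / 2 + 'i * (v / 2)) (v / 2).
Proof.
rewrite /square_sum !edge_sum_halve !mulrA.
have -> : z + v / 2 + v / 2 = z + v by field.
have -> : z + 'i * v / 2 + 'i * v / 2 = z + 'i * v by field.
have -> : z + v / 2 + 'i * v / 2 + 'i * v / 2 = z + v / 2 + 'i * v by field.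
have -> : z + v / 2 + 'i * v / 2 + v / 2 = z + v + 'i * v / 2 by field.
have -> : z + 'i * v / 2 + v / 2 = z + v / 2 + 'i * v / 2 by field.
have -> : z + 'i * v + v / 2 = z + v / 2 + 'i * v by ring.
ring.
Qed.

Lemma edge_sumD phi psi n z v :
  edge_sum (fun x => phi x + psi x) n z v = edge_sum phi n z v + edge_sum psi n z v.
Proof. by rewrite /edge_sum big_split mulrDl. Qed.

(** The increment [b * w * v] is symmetric in [w] and [v]; this is why the two pairs of opposite
    sides of a square cancel on affine functions. *)
Lemma edge_sum_affine (a b : R[i]) n z w v :
  edge_sum (fun x => a + b * x) n (z + w) v =
  edge_sum (fun x => a + b * x) n z v + b * w * v.
Proof.
have n2 : (2 ^+ n : R[i]) != 0 by rewrite expf_neq0.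
have -> : b * w * v = (\sum_(j < 2 ^ n) (b * w)) * (v / 2 ^+ n).
  by rewrite sumr_const card_ord -[_ *+ (2 ^ n)]mulr_natl natrX; field.
rewrite /edge_sum -mulrDl -big_split /=; congr (_ * _); apply: eq_bigr => j _.
ring.
Qed.

Lemma edge_sum_le phi n z v (e : R) :
    (forall t : R, 0 <= t <= 1 -> normc (phi (z + v * t%:C)) <= e) ->
  normc (edge_sum phi n z v) <= e * normc v.
Proof.
move=> phi_le; rewrite normcM.
have -> : e * normc v = (\sum_(j < 2 ^ n) e) * normc (v / 2 ^+ n).
  rewrite sumr_const card_ord -[_ *+ (2 ^ n)]mulr_natl natrX normcM normcV normc_exp.
  rewrite (normc_natr R 2); field; by rewrite expf_neq0.
apply: ler_wpM2r; first exact: normc_ge0.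
apply: le_trans (normc_sum _ _ _) _; apply: ler_sum => j _.
have -> : (j%:R / 2 ^+ n : R[i]) = (j%:R / 2 ^+ n)%:C.
  by rewrite rmorphM fmorphV rmorphXn !rmorph_nat.
apply: phi_le; rewrite divr_ge0 ?exprn_ge0//= ler_pdivrMr ?exprn_gt0// mul1r.
by rewrite -natrX ler_nat ltnW.
Qed.

(** The affine part contributes nothing, so only the deviation of [phi] from it counts; all nodes of
    the four edges lie within [2 * normc v] of [z]. *)
Lemma square_sum_le phi n z v a b (e : R) :
    (forall x, normc (x - z) <= 2 * normc v -> normc (phi x - a - b * x) <= e) ->
  normc (square_sum phi n z v) <= 4 * e * normc v.
Proof.
move=> phi_le; pose psi x := phi x - a - b * x.
have phiE : phi = fun x => (a + b * x) + psi x.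
  by apply/funext => x; rewrite /psi; ring.
have -> : square_sum phi n z v = square_sum psi n z v.
  rewrite /square_sum phiE !(edge_sumD (fun x => a + b * x) psi) !edge_sum_affine.
  ring.
have ve t : 0 <= t <= 1 -> normc (v * t%:C) <= normc v.
  by case/andP=> t0 t1; rewrite normcM normc_real ger0_norm// ler_piMr ?normc_ge0.
have ive t : 0 <= t <= 1 -> normc ('i * v * t%:C) <= normc v.
  by move=> t01; rewrite -mulrA normcM normc_i mul1r ve.
have v0 := normc_ge0 v.
have cancel (x y : R[i]) : z + x + y - z = x + y by ring.
have iv : normc ('i * v) = normc v by rewrite normcM normc_i mul1r.
have E1 : normc (edge_sum psi n z v) <= e * normc v.
  apply: edge_sum_le => t t01; apply: phi_le; rewrite addrC addKr.
  by have := ve _ t01; lra.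
have E2 : normc (edge_sum psi n (z + v) ('i * v)) <= e * normc v.
  rewrite -iv; apply: edge_sum_le => t t01; apply: phi_le.
  rewrite cancel; apply: le_trans (le_normcD _ _) _.
  by have := ive _ t01; lra.
have E3 : normc (edge_sum psi n (z + 'i * v) v) <= e * normc v.
  apply: edge_sum_le => t t01; apply: phi_le.
  rewrite cancel; apply: le_trans (le_normcD _ _) _.
  by have := ve _ t01; lra.
have E4 : normc (edge_sum psi n z ('i * v)) <= e * normc v.
  rewrite -iv; apply: edge_sum_le => t t01; apply: phi_le; rewrite addrC addKr.
  by have := ive _ t01; lra.
rewrite /square_sum.
apply: le_trans (normcB_le _ _) _; apply: le_trans (lerD (normcB_le _ _) E4) _.
apply: le_trans (lerD (lerD (le_normcD _ _) E3) (lexx _)) _; lra.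
Qed.

(** Bisection by contradiction: failure on a square passes, relative to its area, to one of its
    quarters, and the corners converge to a point where differentiability excludes it. *)
Lemma goursat_square phi z v : (forall x, exists d, cderiv phi x d) ->
  forall e : R, 0 < e -> exists m, forall n, (m <= n)%N ->
    normc (square_sum phi n z v) <= e.
Proof.
move=> dphi e e0; apply/not_existsP => no_m.
have v_neq0 : v != 0.
  apply/eqP => v0; apply: (no_m 0) => n _.
  rewrite /square_sum /edge_sum v0 !mulr0 !mul0r !mulr0 !addr0 !subr0.
  by rewrite normc0 ltW.
have v_gt0 : 0 < normc v by rewrite normc_gt0.
pose eta := e / normc v ^+ 2.
have eta_gt0 : 0 < eta by rewrite divr_gt0 ?exprn_gt0.
(* Failure means that arbitrarily fine subdivisions exceed [eta] times the squared side. If the four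
   quarters were good, their bounds would add up to the bound for the whole square. *)
pose bad k x := forall m, exists2 n, (m <= n)%N &
  eta * normc (v / 2 ^+ k) ^+ 2 < normc (square_sum phi n x (v / 2 ^+ k)).
have bad0 : bad 0 z.
  move=> m; apply/not_exists2P => small; apply: (no_m m) => n mn.
  case: (small n) => // /negP; rewrite -leNgt expr0 divr1.
  by rewrite /eta divfK// expf_neq0// normc_eq0.
have vk k : v / 2 ^+ k.+1 = v / 2 ^+ k / 2 by rewrite exprS; field; rewrite expf_neq0.
have nvk k : normc (v / 2 ^+ k) = normc v / 2 ^+ k.
  by rewrite normcM normcV normc_exp (normc_natr R 2).
have bad_step k x : bad k x -> exists y, bad k.+1 y /\ normc (y - x) <= normc v / 2 ^+ k.
  move=> bx; apply/not_existsP => no_y.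
  have good y : normc (y - x) <= normc v / 2 ^+ k -> exists m, forall n, (m <= n)%N ->
    normc (square_sum phi n y (v / 2 ^+ k / 2)) <= eta * normc (v / 2 ^+ k / 2) ^+ 2.
    move=> yx; apply/not_existsP => no_n; apply: (no_y y); split=> // m.
    apply/not_exists2P => small; apply: (no_n m) => n mn.
    by case: (small n) => // /negP; rewrite -leNgt vk.
  set w := v / 2 ^+ k / 2 in good.
  have nw : normc v / 2 ^+ k = 2 * normc w.
    by rewrite /w normcM nvk normcV (normc_natr R 2); field; rewrite expf_neq0.
  have w0 := normc_ge0 w; have iw : normc ('i * w) = normc w.
    by rewrite normcM normc_i mul1r.
  have [|m1 g1] := good x; first by rewrite subrr normc0 nw mulr_ge0.
  have [|m2 g2] := good (x + w); first by rewrite (addrC x) addrK nw; lra.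
  have [|m3 g3] := good (x + 'i * w); first by rewrite (addrC x) addrK iw nw; lra.
  have [|m4 g4] := good (x + w + 'i * w).
    have -> : x + w + 'i * w - x = w + 'i * w by ring.
    apply: le_trans (le_normcD _ _) _.
    by rewrite iw nw; lra.
  (* The extra unit pays for the bisection, which turns subdivision [n.+1] of the square into
     subdivision [n] of its quarters. *)
  have [[//|n] mn] := bx (maxn (maxn m1 m2) (maxn m3 m4)).+1.
  move: mn; rewrite ltnS !geq_max => /andP[/andP[n1 n2] /andP[n3 n4]].
  rewrite square_sum_split -/w ltNge => /negP; apply.
  rewrite nvk nw.
  apply: le_trans (le_normcD _ _) _.
  apply: le_trans (lerD (le_normcD _ _) (g4 _ n4)) _.
  apply: le_trans (lerD (lerD (le_normcD _ _) (g3 _ n3)) (lexx _)) _.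
  apply: le_trans (lerD (lerD (lerD (g1 _ n1) (g2 _ n2)) (lexx _)) (lexx _)) _.
  by rewrite le_eqVlt; apply/orP; left; apply/eqP; ring.
have /choice[nxt nxtP] (p : nat * R[i]) : exists y, bad p.1 p.2 ->
    bad p.1.+1 y /\ normc (y - p.2) <= normc v / 2 ^+ p.1.
  have [b|nb] := pselect (bad p.1 p.2); last by exists 0.
  by have [y yP] := bad_step _ _ b; exists y.
pose u := fix u k := if k is k'.+1 then nxt (k', u k') else z.
have bu k : bad k (u k).
  by elim: k => [//|k IHk]; have [] := nxtP (k, u k) IHk.
have [l ul] := @geometric_cauchy_limitC R u (normc v)
  (fun k => (nxtP (k, u k) (bu k)).2).
have [d dl] := dphi l.
(* The nodes of the square lie within [(2 + 4) * (normc v / 2 ^+ k)] of [l], and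
   [6 * (eta / 48) <= eta / 4], the deviation that [square_sum_le] turns into [eta] times the
   squared side. *)
have [|del del0 phi_del] := dl (eta / 48); first by rewrite divr_gt0.
have [k kdel] := geometric_small (normc v) (divr_gt0 del0 (ltr0n _ 6)).
have [n _] := bu k 0; rewrite ltNge => /negP; apply.
apply: le_trans (@square_sum_le phi n (u k) (v / 2 ^+ k) (phi l - d * l) d
  (eta / 4 * normc (v / 2 ^+ k)) _) _; last first.
  by rewrite le_eqVlt; apply/orP; left; apply/eqP; field.
rewrite nvk => x xu.
have xl : normc (x - l) <= 6 * (normc v / 2 ^+ k).
  apply: le_trans (normc_dist_triangle (u k) _ _) _.
  by have := ul k; rewrite -mulrA; lra.
have := phi_del (x - l); rewrite (_ : l + (x - l) = x); last by ring.
have -> : phi x - phi l - d * (x - l) = phi x - (phi l - d * l) - d * x by ring.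
move=> H; apply: le_trans (H _) _; first lra.
have : 0 < eta / 48 by rewrite divr_gt0.
have := normc_ge0 (x - l); nra.
Qed.

End Goursat.

(** * Complex differentiability and closure properties of entire functions *)

Section Entire.
Variable R : realType.
Implicit Types (f g phi : R[i]^o -> R[i]^o) (z w d : R[i]).

Lemma normC_normc z : `|z| = (normc z)%:C.
Proof. by []. Qed.

Lemma gt0_complexP z : 0 < z -> exists2 e : R, 0 < e & z = e%:C.
Proof.
case: z => a b; rewrite ltcE /= => /andP[/eqP -> a0].
by exists a.
Qed.

Lemma derivableP_cderiv f z : derivable f z 1 <-> exists d, cderiv f z d.
Proof.
split=> [/cvg_ex[/= d fd]|[d fd]].
  exists d => e e0; move/cvgrPdist_le : fd => /(_ e%:C); rewrite ltcR => /(_ e0).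
  move=> /nbhs_ballP[_/= /gt0_complexP[del del0 ->] sub].
  exists del => // h hdel; have [->|h0] := eqVneq h 0.
    by rewrite addr0 mulr0 !subrr normc0 mulr0.
  have := sub h; rewrite /ball/= sub0r normrN normC_normc ltcR => /(_ hdel h0).
  rewrite normC_normc lecR => le_e.
  have -> : f (z + h) - f z - d * h = - (d - h^-1 *: (f (h *: 1 + z) - f z)) * h.
    rewrite -[h *: 1]/(h * 1) mulr1 addrC [z + h]addrC.
    rewrite -[_ *: _]/(h^-1 * _); field; exact: h0.
  by rewrite normcM normcN ler_wpM2r ?normc_ge0.
apply/cvg_ex; exists d; apply/cvgrPdist_le => _ /gt0_complexP[e e0 ->].
have [del del0 sub] := fd _ e0.
apply/nbhs_ballP; exists del%:C => /=; first by rewrite ltcR.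
move=> h; rewrite /ball/= sub0r normrN normC_normc ltcR => hdel h0.
rewrite normC_normc lecR -(ler_pM2r (_ : 0 < normc h)) ?normc_gt0//.
rewrite -normcM -normcN; apply: le_trans (sub h hdel).
rewrite le_eqVlt; apply/orP; left; apply/eqP; congr normc.
rewrite -[h *: 1]/(h * 1) mulr1 [z + h]addrC.
by rewrite -[_ *: _]/(h^-1 * _); field; exact: h0.
Qed.

Lemma entireP f : entire R f <-> forall z, exists d, cderiv f z d.
Proof. by split=> df z; apply/derivableP_cderiv; exact: df. Qed.

Lemma entire_cst (c : R[i]) : entire R (fun=> c).
Proof. by move=> z; exact: derivable_cst. Qed.

Lemma entire_id : entire R id.
Proof. by move=> z; exact: derivable_id. Qed.

Lemma entireD f g : entire R f -> entire R g -> entire R (fun z => f z + g z).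
Proof. by move=> df dg z; apply: derivableD; [exact: df|exact: dg]. Qed.

Lemma entireN f : entire R f -> entire R (fun z => - f z).
Proof. by move=> df z; apply: derivableN; exact: df. Qed.

Lemma entireB f g : entire R f -> entire R g -> entire R (fun z => f z - g z).
Proof. by move=> df dg; exact: (entireD df (entireN dg)). Qed.

Lemma entireM f g : entire R f -> entire R g -> entire R (fun z => f z * g z).
Proof. by move=> df dg z; apply: derivableM; [exact: df|exact: dg]. Qed.

Lemma entireX f n : entire R f -> entire R (fun z => f z ^+ n).
Proof.
move=> df; elim: n => [|n IHn]; first exact: entire_cst.
rewrite (_ : (fun _ => _) = fun z => f z * f z ^+ n); first exact: entireM.
by apply/funext => z; rewrite exprS.
Qed.

Lemma entire_comp f g : entire R f -> entire R g -> entire R (fun z => f (g z)).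
Proof.
move=> df dg z; apply/derivable1_diffP.
apply: (@differentiable_comp _ _ _ _ g f); apply/derivable1_diffP; first exact: dg.
exact: df.
Qed.

Lemma entire_continuous f : entire R f -> continuous f.
Proof. by move=> df z; apply: differentiable_continuous; apply/derivable1_diffP. Qed.

End Entire.

Arguments entire_cst {R} c _.
Arguments entire_id : clear implicits.
Arguments entireX {R f} n _ _.

(** * The complex exponential *)

Section ComplexExponential.
Variable R : realType.
Implicit Types (z w : R[i]) (t : R).

Definition cexp z : R[i] :=
  (expR (complex.Re z))%:C * (cos (complex.Im z) +i* sin (complex.Im z)).

Lemma cexpE (a b : R) : cexp (a +i* b) = (expR a * cos b) +i* (expR a * sin b).
Proof. by rewrite /cexp; simpc. Qed.

Lemma cexpD z w : cexp (z + w) = cexp z * cexp w.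
Proof.
rewrite /cexp !raddfD /= expRD cosD sinD rmorphM /= mulrACA; congr (_ * _).
by apply/eqP; rewrite eq_complex /= eqxx/= addrC.
Qed.

Lemma normc_cexp z : normc (cexp z) = expR (complex.Re z).
Proof.
by rewrite normcM normc_real ger0_norm ?expR_ge0//= cos2Dsin2 sqrtr1 mulr1.
Qed.

Lemma cexp0 : cexp 0 = 1.
Proof. by rewrite /cexp /= expR0 cos0 sin0 mul1r. Qed.

Lemma cexp_neq0 z : cexp z != 0.
Proof. by rewrite -normc_gt0 normc_cexp expR_gt0. Qed.

Lemma cexpN z : cexp (- z) = (cexp z)^-1.
Proof.
by apply: (mulIf (cexp_neq0 z)); rewrite -cexpD addNr cexp0 mulVf// cexp_neq0.
Qed.

Lemma cexp_nat n z : cexp (n%:R * z) = cexp z ^+ n.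
Proof.
elim: n => [|n IHn]; first by rewrite mul0r cexp0 expr0.
by rewrite -natr1 mulrDl mul1r cexpD IHn exprSr.
Qed.

Lemma cexp_2pi : cexp ('i * (2 * pi)%:C) = 1.
Proof.
rewrite /cexp (_ : 'i * (2 * pi)%:C = 0 +i* (2 * pi)); last by simpc.
by rewrite /= expR0 mul1r mulr_natl cos2pi sin2pi.
Qed.

Lemma is_derive_eps (g : R -> R) (x d : R) : is_derive x 1 g d ->
  forall e : R, 0 < e -> exists2 del, 0 < del &
  forall h, `|h| < del -> `|g (x + h) - g x - d * h| <= e * `|h|.
Proof.
move=> [gd gx] e e0.
move/cvg_ex: (gd) => [/= d' gd'].
have dd' : d' = d by rewrite -gx; apply/esym/cvg_lim.
move: gd'; rewrite dd' => /cvgrPdist_le /(_ _ e0).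
move=> /nbhs_ballP[del /= del0 sub]; exists del => // h hdel.
have [->|h0] := eqVneq h 0.
  by rewrite addr0 mulr0 !subrr normr0 mulr0.
have := sub h; rewrite /ball/= sub0r normrN => /(_ hdel h0) le_e.
have -> : g (x + h) - g x - d * h = - (d - h^-1 *: (g (h *: 1 + x) - g x)) * h.
  rewrite -[h *: 1]/(h * 1) mulr1 [x + h]addrC -[_ *: _]/(h^-1 * _).
  by field.
by rewrite normrM normrN ler_wpM2r.
Qed.

(** In the expansion of [expR a * cos b] and [expR a * sin b], every error term contains a
    first-order remainder of a real function or is the quadratic term [a * b]. *)
Lemma cderiv_cexp0 : cderiv cexp 0 1.
Proof.
move=> e e0.
have ed : is_derive (0 : R) 1 expR 1 by have := is_derive_expR (0 : R); rewrite expR0.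
have cd : is_derive (0 : R) 1 cos 0 by have := is_derive_cos (0 : R); rewrite sin0 oppr0.
have sd : is_derive (0 : R) 1 sin 1 by have := is_derive_sin (0 : R); rewrite cos0.
(* The errors will add up to at most nine times [k * n], where [k] is this minimum and [n] the
   modulus of the increment. *)
have e8 : 0 < Num.min 1 (e / 16) by rewrite lt_min ltr01 divr_gt0.
have [d1 d10 H1] := is_derive_eps ed e8.
have [d2 d20 H2] := is_derive_eps cd e8.
have [d3 d30 H3] := is_derive_eps sd e8.
set k := Num.min 1 (e / 16) in e8 H1 H2 H3.
have k1 : k <= 1 by rewrite /k ge_min lexx.
have ke : k <= e / 16 by rewrite /k ge_min lexx orbT.
clearbody k.
exists (Num.min (Num.min d1 d2) (Num.min d3 k)).
  by rewrite !lt_min d10 d20 d30 e8.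
case=> a b hlt; have ha := le_lt_trans (Re_le_normc (a +i* b)) hlt.
have hb := le_lt_trans (Im_le_normc (a +i* b)) hlt.
have {H1} := H1 a; have {H2} := H2 b; have {H3} := H3 b.
have na := Re_le_normc (a +i* b); have nb := Im_le_normc (a +i* b).
move: ha hb hlt na nb; rewrite !lt_min.
move=> /andP[/andP[a1 _] /andP[_ ak]] /andP[/andP[_ b2] /andP[b3 bk]] _ na nb.
rewrite !add0r expR0 cos0 sin0 mul0r subr0 subr0 !mul1r => /(_ b3) S /(_ b2) C /(_ a1) E.
rewrite cexp0; apply: le_trans (normc_le_ReIm _) _.
set n := normc (a +i* b) in na nb *; clearbody n.
rewrite cexpE !raddfB /= subr0.
rewrite /= in na nb.
have a0 := normr_ge0 a; have b0 := normr_ge0 b.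
have E' : `|expR a| <= 3.
  have -> : expR a = (expR a - 1 - a) + 1 + a by ring.
  apply: le_trans (ler_normD _ _) _.
  apply: le_trans (lerD (ler_normD _ _) (lexx _)) _.
  rewrite normr1; have : `|a| <= 1 by lra.
  nra.
have -> : expR a * cos b - 1 - a = expR a * (cos b - 1) + (expR a - 1 - a) by ring.
have -> : expR a * sin b - b =
  expR a * (sin b - b) + (expR a - 1 - a) * b + a * b by ring.
apply: le_trans (lerD (ler_normD _ _) (ler_normD _ _)) _.
apply: le_trans (lerD (lexx _) (lerD (ler_normD _ _) (lexx _))) _.
rewrite !normrM.
have n0 : 0 <= n := le_trans a0 na.
have k0 : 0 <= k := ltW e8.
have kn0 : 0 <= k * n by rewrite mulr_ge0.
have kan : k * `|a| <= k * n by rewrite ler_wpM2l.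
have kbn : k * `|b| <= k * n by rewrite ler_wpM2l.
have h1 : `|expR a| * `|cos b - 1| <= 3 * (k * n).
  by apply: ler_pM => //; apply: le_trans kbn.
have h2 : `|expR a| * `|sin b - b| <= 3 * (k * n).
  by apply: ler_pM => //; apply: le_trans kbn.
have h3 : `|expR a - 1 - a| * `|b| <= k * n * 1.
  by apply: ler_pM => //; [apply: le_trans kan|lra].
have h4 : `|a| * `|b| <= n * k by apply: ler_pM => //; lra.
have h5 : k * n <= e / 16 * n by rewrite ler_wpM2r.
lra.
Qed.

(** The addition formula carries the derivative from 0 to [z]. *)
Lemma cderiv_cexp z : cderiv cexp z (cexp z).
Proof.
move=> e e0; have z0 : 0 < normc (cexp z) by rewrite normc_gt0 cexp_neq0.
have [del del0 H] := cderiv_cexp0 (divr_gt0 e0 z0).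
exists del => // h hdel; have := H h hdel; rewrite add0r cexp0 mul1r => le_h.
rewrite cexpD -{2}[cexp z]mulr1 -!mulrBr normcM.
by rewrite -ler_pdivlMl// mulrA [_^-1 * _]mulrC.
Qed.

Lemma entire_cexp : entire R cexp.
Proof. by apply/entireP => z; exists (cexp z); exact: cderiv_cexp. Qed.

End ComplexExponential.

(** * Cauchy's estimate and Lipschitz bounds on discs *)

Section CauchyEstimate.
Variable R : realType.
Implicit Types (f phi : R[i]^o -> R[i]^o) (z w d l : R[i]).

Lemma edge_sum_shift_period phi n z v p : (forall x, phi (x + p) = phi x) ->
  edge_sum phi n (z + p) v = edge_sum phi n z v.
Proof.
move=> per; rewrite /edge_sum; congr (_ * _); apply: eq_bigr => j _.
by rewrite addrAC per.
Qed.

(* By periodicity the horizontal edges cancel in Goursat's lemma, so the mean of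
   [phi] over a vertical period does not depend on its abscissa. *)
Lemma periodic_limit_le phi (K : R) l : entire R phi ->
    (forall x, phi (x + 'i * (2 * pi)%:C) = phi x) ->
    (forall x, complex.Re x = 0 -> normc (phi x) <= K) ->
    (forall e : R, 0 < e -> exists A : R, forall x, complex.Re x <= A ->
       normc (phi x - l) <= e) ->
  normc l <= K.
Proof.
move=> /entireP dphi per K_bound lim_l; pose L : R := 2 * pi.
have L0 : 0 < L by rewrite mulr_gt0 ?pi_gt0.
pose V n z := edge_sum phi n z ('i * L%:C).
have stepV n z : square_sum phi n z L%:C = V n (z + L%:C) - V n z.
  by rewrite /square_sum (edge_sum_shift_period _ _ _ per) /V; ring.
(* The vertical edge is moved to the left by one square of side [L] at a time; each move costs an
   arbitrarily small Goursat error. *)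
have V_lim m e : 0 < e -> exists n0, forall n, (n0 <= n)%N ->
    normc (V n 0 - V n (- m%:R * L%:C)) <= e.
  elim: m e => [|m IHm] e e0.
    by exists 0 => n _; rewrite mulNr mul0r oppr0 subrr normc0 ltW.
  have e2 : 0 < e / 2 by rewrite divr_gt0.
  have [n1 H1] := IHm _ e2.
  have [n2 H2] := goursat_square (- m.+1%:R * L%:C) L%:C dphi e2.
  exists (maxn n1 n2) => n; rewrite geq_max => /andP[/H1 h1 /H2].
  rewrite stepV (_ : - m.+1%:R * L%:C + L%:C = - m%:R * L%:C); last first.
    by rewrite -natr1; ring.
  move=> h2; apply: le_trans (normc_dist_triangle _ _ _) (le_trans (lerD h1 h2) _).
  by rewrite -splitr.
have iL : normc ('i * L%:C) = L.
  by rewrite normcM normc_i mul1r normc_real ger0_norm// ltW.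
apply/ler_addgt0Pr => e e0.
have e2 : 0 < e / 2 by rewrite divr_gt0.
have [A HA] := lim_l _ e2.
have [m mA] : exists m : nat, - m%:R * L <= A.
  exists (Num.bound `|A / L|); rewrite mulNr lerNl -ler_pdivrMr//.
  rewrite mulNr; apply: le_trans (ler_norm _) _; rewrite normrN.
  exact/ltW/archi_boundP/normr_ge0.
have [n0 Hn0] := V_lim m _ (mulr_gt0 e2 L0).
have V0 : normc (V n0 0) <= K * L.
  rewrite -[X in _ <= _ * X]iL; apply: edge_sum_le => t _; apply: K_bound.
  by rewrite add0r; simpc.
have Vl : normc (V n0 (- m%:R * L%:C) - l * ('i * L%:C)) <= e / 2 * L.
  have -> : V n0 (- m%:R * L%:C) - l * ('i * L%:C) =
      edge_sum (fun x => phi x - l) n0 (- m%:R * L%:C) ('i * L%:C).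
    rewrite edge_sumD -/(V _ _); congr (_ + _); rewrite /edge_sum.
    rewrite sumr_const card_ord -[_ *+ (2 ^ n0)]mulr_natl natrX; field.
    by rewrite expf_neq0.
  rewrite -[X in _ <= _ * X]iL; apply: edge_sum_le => t _; apply: HA.
  rewrite (_ : complex.Re _ = - m%:R * L)//.
  rewrite raddfD /= -(rmorph_nat (real_complex R)) -rmorphN -rmorphM /=.
  by rewrite !mul0r !mul1r ?mul0r ?subr0 ?addr0; ring.
have := Hn0 n0 (leqnn _) => V_near.
have : normc (l * ('i * L%:C)) <= (K + e) * L.
  have -> : l * ('i * L%:C) = V n0 0 - (V n0 0 - V n0 (- m%:R * L%:C))
     - (V n0 (- m%:R * L%:C) - l * ('i * L%:C)) by ring.
  apply: le_trans (normcB_le _ _) _.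
  apply: le_trans (lerD (normcB_le _ _) (lexx _)) _; lra.
by rewrite normcM iL ler_pM2r.
Qed.

(* In the coordinate [z = w + cexp x], the difference quotient of [f] at [w] becomes
   an entire periodic function with limit [d] at the left end. *)
Lemma cauchy_estimate f w d (K : R) : entire R f -> cderiv f w d ->
    (forall z, normc (z - w) <= 1 -> normc (f z) <= K) ->
  normc d <= 2 * K.
Proof.
move=> df fd K_bound.
pose phi x : R[i] := (f (w + cexp x) - f w) * cexp (- x).
apply: (@periodic_limit_le phi).
- have exp_neg := entire_comp (@entire_cexp R) (entireN (entire_id R)).
  have exp_shift := entireD (entire_cst w) (@entire_cexp R).
  exact: (entireM (entireB (entire_comp df exp_shift) (entire_cst (f w))) exp_neg).
- by move=> x; rewrite /phi !cexpN cexpD cexp_2pi mulr1.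
(* For [x] on the imaginary axis, [w + cexp x] lies on the unit circle around [w]. *)
- move=> x x0; rewrite normcM cexpN normcV normc_cexp x0 expR0 invr1 mulr1.
  apply: le_trans (normcB_le _ _) _; rewrite mulrDl mul1r; apply: lerD; apply: K_bound.
    by rewrite addrC addKr normc_cexp x0 expR0.
  by rewrite subrr normc0.
- move=> e e0; have [del del0 Hdel] := fd e e0.
  exists (ln (del / 2)) => x xle.
  have hx : normc (cexp x) < del.
    rewrite normc_cexp; apply: (@le_lt_trans _ _ (expR (ln (del / 2)))).
      by rewrite ler_expR.
    by rewrite lnK ?posrE ?divr_gt0//; lra.
  have -> : phi x - d = (f (w + cexp x) - f w - d * cexp x) / cexp x.
    by rewrite /phi cexpN; field; exact: cexp_neq0.
  rewrite normcM normcV ler_pdivrMr ?normc_gt0 ?cexp_neq0//.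
  exact: Hdel.
Qed.

(** The real mean value theorem is applied to the real part of [c * f] along the segment, where [c]
    is the conjugate of [s = f z - f w]; its increment is then the square of the modulus of [s]. *)
Lemma segment_mean_value f (f' : R[i] -> R[i]) z w (K : R) :
    (forall x, cderiv f x (f' x)) ->
    (forall t : R, 0 <= t <= 1 -> normc (f' (w + t%:C * (z - w))) <= K) ->
  normc (f z - f w) <= K * normc (z - w).
Proof.
move=> df K_bound.
have [fzw|s0] := eqVneq (normc (f z - f w)) 0.
  rewrite fzw mulr_ge0 ?normc_ge0//.
  by apply: le_trans (normc_ge0 _) (K_bound 0 _); rewrite lexx ler01.
set s := f z - f w in s0 *.
have s_gt0 : 0 < normc s by rewrite lt_neqAle eq_sym s0 normc_ge0.
pose c : R[i] := s^*%C.
have cs : c * s = (normc s ^+ 2)%:C.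
  by rewrite mulrC -sqr_normc normC_normc rmorphXn.
have nc : normc c = normc s.
  by apply: complexI; rewrite -!normC_normc normcJ.
pose u (t : R) := complex.Re (c * f (w + t%:C * (z - w))).
pose u' (t : R) := complex.Re (c * f' (w + t%:C * (z - w)) * (z - w)).
have du (t : R) : is_derive t 1 u (u' t).
  have key : (fun h => h^-1 *: ((u \o shift t) (h *: 1) - u t)) @ 0^' --> u' t.
    apply/cvgrPdist_le => e e0.
    (* The summand 1 keeps [k] positive when [z = w]. *)
    pose k := normc c * (normc (z - w) + 1).
    have k0 : 0 < k by rewrite mulr_gt0 ?nc// ltr_wpDl ?normc_ge0.
    have [del del0 Hdel] := df (w + t%:C * (z - w)) _ (divr_gt0 e0 k0).
    have zw1 : 0 < normc (z - w) + 1 by rewrite ltr_wpDl ?normc_ge0.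
    apply/nbhs_ballP; exists (del / (normc (z - w) + 1)) => /=.
      by rewrite divr_gt0.
    move=> h; rewrite /ball /= sub0r normrN ltr_pdivlMr// => hdel h0.
    have h_gt0 : 0 < `|h| by rewrite normr_gt0.
    rewrite -(ler_pM2r h_gt0) -normrM.
    rewrite -[h *: 1]/(h * 1) mulr1 -[h^-1 *: _]/(h^-1 * _).
    have -> : (u' t - h^-1 * (u (h + t) - u t)) * h = u' t * h - (u (h + t) - u t).
      by field.
    have -> : u' t * h = complex.Re (c * f' (w + t%:C * (z - w)) * (z - w) * h%:C).
      by rewrite /u'; case: (_ * (z - w)) => x y /=; rewrite mulr0 subr0.
    rewrite /u -!raddfB; apply: le_trans (Re_le_normc _) _.
    set x := w + t%:C * (z - w) in Hdel *.
    have -> : w + (h + t)%:C * (z - w) = x + h%:C * (z - w).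
      by rewrite /x rmorphD /=; ring.
    rewrite -normcN.
    have -> : - (c * f' x * (z - w) * h%:C - (c * f (x + h%:C * (z - w)) - c * f x))
      = c * (f (x + h%:C * (z - w)) - f x - f' x * (h%:C * (z - w))) by ring.
    rewrite normcM.
    have hzw : normc (h%:C * (z - w)) = `|h| * normc (z - w).
      by rewrite normcM normc_real.
    have := Hdel (h%:C * (z - w)); rewrite hzw => H.
    have {}H : normc (f (x + h%:C * (z - w)) - f x - f' x * (h%:C * (z - w))) <=
      e / k * (`|h| * normc (z - w)).
      by apply: H; apply: le_lt_trans hdel; rewrite ler_wpM2l// lerDl.
    apply: le_trans (ler_wpM2l (normc_ge0 _) H) _.
    have -> : e / k = e / normc c / (normc (z - w) + 1).
      by rewrite /k; field; rewrite nc s0 (gt_eqF zw1).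
    have -> : normc c * (e / normc c / (normc (z - w) + 1) * (`|h| * normc (z - w)))
      = e * `|h| * (normc (z - w) / (normc (z - w) + 1)).
      by field; rewrite nc s0 (gt_eqF zw1).
    apply: ler_piMr; first by rewrite mulr_ge0// ltW.
    by rewrite ler_pdivrMr// mul1r; lra.
  by split; [apply/cvg_ex; exists (u' t)|exact/cvg_lim].
have [|t t01] := @MVT R u u' 0 1 ltr01 (fun t _ => du t).
  apply: continuous_subspaceT => t; apply: differentiable_continuous.
  by apply/derivable1_diffP; case: (du t).
rewrite subr0 mulr1 => ut.
have : u 1 - u 0 = normc s ^+ 2.
  rewrite /u -raddfB -mulrBr mul1r mul0r addr0 (_ : w + (z - w) = z); last by ring.
  by rewrite -/s cs.
rewrite {}ut => ut.
have : u' t <= normc s * (K * normc (z - w)).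
  apply: le_trans (ler_norm _) _; apply: le_trans (Re_le_normc _) _.
  rewrite -mulrA normcM nc ler_wpM2l ?normc_ge0// normcM.
  rewrite ler_wpM2r ?normc_ge0//; apply: K_bound.
  by move: t01; rewrite in_itv /= => /andP[t0 t1]; rewrite !ltW.
by rewrite ut expr2 ler_pM2l.
Qed.

(** Cauchy's estimate on unit discs around the points of the segment bounds the derivative by
    [2 * K]; hence the radius [rho + 1]. *)
Lemma lipschitz_on_disc f (rho K : R) z w : entire R f ->
    (forall x, normc x <= rho + 1 -> normc (f x) <= K) ->
    normc z <= rho -> normc w <= rho ->
  normc (f z - f w) <= 2 * K * normc (z - w).
Proof.
move=> df K_bound zrho wrho; have /entireP/choice[f' f'P] := df.
apply: (segment_mean_value f'P) => t /andP[t0 t1].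
apply: (cauchy_estimate df (f'P _)) => x xle; apply: K_bound.
rewrite -[x](subrK (w + t%:C * (z - w))).
apply: le_trans (le_normcD _ _) _; rewrite addrC; apply: lerD => //.
have -> : w + t%:C * (z - w) = (1 - t)%:C * w + t%:C * z by rewrite rmorphB; ring.
apply: le_trans (le_normcD _ _) _.
rewrite !normcM !normc_real (ger0_norm t0) ger0_norm ?subr_ge0//.
have := normc_ge0 z; nra.
Qed.

End CauchyEstimate.

(** * Locally uniform limits of entire functions *)

Section Weierstrass.
Variable R : realType.
Implicit Types (f g : R[i]^o -> R[i]^o) (z w d : R[i]).

Lemma cderivB f g z d d' : cderiv f z d -> cderiv g z d' ->
  cderiv (fun x => f x - g x) z (d - d').
Proof.
move=> fd gd e e0; have e2 : 0 < e / 2 by rewrite divr_gt0.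
have [a a0 Ha] := fd _ e2; have [b b0 Hb] := gd _ e2.
exists (Num.min a b); first by rewrite lt_min a0.
move=> h; rewrite lt_min => /andP[/Ha ha /Hb hb].
have -> : f (z + h) - g (z + h) - (f z - g z) - (d - d') * h =
  (f (z + h) - f z - d * h) - (g (z + h) - g z - d' * h) by ring.
by apply: le_trans (normcB_le _ _) _; lra.
Qed.

(** By Cauchy's estimate the derivatives at [z] of fast approximants form a Cauchy sequence; its
    limit is the derivative of [f], because the increments of [f - g k] are uniformly small relative
    to [h]. *)
Lemma entire_locally_uniform_limit f :
    (forall rho e : R, 0 < e -> exists2 g, entire R g &
       forall z, normc z <= rho -> normc (f z - g z) <= e) ->
  entire R f.
Proof.
move=> approx; apply/entireP => z; pose rho := normc z + 1.
(* As [f] is not yet known to be entire, the Lipschitz bound for [f - g] is obtained from [g' - g]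
   with [g'] arbitrarily close to [f]. *)
have lip g e h : entire R g -> 0 <= e ->
    (forall x, normc x <= rho + 1 -> normc (f x - g x) <= e) -> normc h <= 1 ->
    normc ((f (z + h) - f z) - (g (z + h) - g z)) <= 2 * e * normc h.
  move=> dg e0 fg h1; apply/ler_addgt0Pr => eta eta0.
  have [g' dg' fg'] := approx (rho + 1) _ (divr_gt0 eta0 (ltr0n _ 4)).
  have zrho : normc z <= rho by rewrite /rho; lra.
  have zhrho : normc (z + h) <= rho by apply: le_trans (le_normcD _ _) _; rewrite lerD2l.
  have gg' x : normc x <= rho + 1 -> normc (g' x - g x) <= e + eta / 4.
    move=> xr; have := fg x xr; have := fg' x xr.
    rewrite [normc (f x - g' x)]normc_distC => h2 h3.
    by apply: le_trans (normc_dist_triangle (f x) _ _) _; lra.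
  have := lipschitz_on_disc (entireB dg' dg) gg' zhrho zrho.
  rewrite (_ : z + h - z = h); last by ring.
  move=> H; have r1 : rho <= rho + 1 by lra.
  have Hz := fg' z (le_trans zrho r1); have Hzh := fg' _ (le_trans zhrho r1).
  have -> : (f (z + h) - f z) - (g (z + h) - g z) =
    (f (z + h) - g' (z + h)) - (f z - g' z)
    + (g' (z + h) - g (z + h) - (g' z - g z)) by ring.
  apply: le_trans (le_normcD _ _) _.
  apply: le_trans (lerD (normcB_le _ _) (lexx _)) _.
  have := normc_ge0 h; nra.
have i2 k : 0 < (2 ^+ k)^-1 :> R by rewrite invr_gt0 exprn_gt0.
have /choice[g gP] : forall k, exists g, entire R g /\
    forall x, normc x <= rho + 1 -> normc (f x - g x) <= (2 ^+ k)^-1.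
  by move=> k; have [g dg fg] := approx (rho + 1) _ (i2 k); exists g.
have /choice[d dP] : forall k, exists d, cderiv (g k) z d.
  by move=> k; have [/entireP dg _] := gP k; exact: dg.
have [|l dl] := @geometric_cauchy_limitC R d 3.
  move=> k; have [dg1 g1] := gP k.+1; have [dg0 g0] := gP k.
  apply: le_trans (cauchy_estimate (K := 3 / 2 / 2 ^+ k) (entireB dg1 dg0)
     (cderivB (dP k.+1) (dP k)) _) _; last first.
    by rewrite le_eqVlt; apply/orP; left; apply/eqP; field; rewrite expf_neq0.
  move=> x xz; have xr : normc x <= rho + 1.
    by rewrite -[x](subrK z); apply: le_trans (le_normcD _ _) _; rewrite /rho; lra.
  apply: le_trans (normc_dist_triangle (f x) _ _) _.
  rewrite [normc (g k.+1 x - f x)]normc_distC.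
  apply: le_trans (lerD (g1 x xr) (g0 x xr)) _; rewrite exprS le_eqVlt.
  by apply/orP; left; apply/eqP; field; rewrite expf_neq0.
exists l => e e0; have e2 : 0 < e / 2 by rewrite divr_gt0.
(* The constant 14 is 2 from [lip] plus [4 * 3] from the distance of [d k] to [l]. *)
have [k ke] := geometric_small 14 e2.
have [dg fg] := gP k; have [del del0 Hdel] := dP k _ e2.
exists (Num.min del 1); first by rewrite lt_min del0 ltr01.
move=> h; rewrite lt_min => /andP[/Hdel h1 /ltW h2].
have -> : f (z + h) - f z - l * h = ((f (z + h) - f z) - (g k (z + h) - g k z)) +
  (g k (z + h) - g k z - d k * h) + (d k - l) * h by ring.
apply: le_trans (le_normcD _ _) _.
apply: le_trans (lerD (le_normcD _ _) (lexx _)) _; rewrite normcM.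
have h3 := lip _ _ _ dg (ltW (i2 k)) fg h2.
have h4 := ler_wpM2r (normc_ge0 h) (dl k).
have h5 := ler_wpM2r (normc_ge0 h) (ltW ke).
apply: le_trans (lerD (lerD h3 h1) h4) _; lra.
Qed.

End Weierstrass.

(** * Compact discs and the topology of the space of entire functions *)

Section Topology.
Variable R : realType.
Implicit Types (f g : R[i]^o -> R[i]^o) (z w : R[i]^o) (rho e : R).

Definition disc rho : set R[i]^o := [set z | normc z <= rho].

Lemma nbhs_complexP z (U : set R[i]^o) :
  nbhs z U <-> exists2 e, 0 < e & forall w, normc (w - z) < e -> U w.
Proof.
split=> [/nbhs_ballP[_/= /gt0_complexP[e e0 ->] sub]|[e e0 sub]].
  by exists e => // w wz; apply: sub; rewrite /ball /= normC_normc ltcR normc_distC.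
apply/nbhs_ballP; exists e%:C => /=; first by rewrite ltcR.
by move=> w; rewrite /ball /= normC_normc ltcR normc_distC; exact: sub.
Qed.

Lemma closed_disc rho : closed (disc rho).
Proof.
rewrite closedE => z nz; rewrite /disc/= leNgt; apply/negP => rz; apply: nz.
apply/nbhs_complexP; exists (normc z - rho); first by rewrite subr_gt0.
move=> w wz /=; rewrite /disc /= => wrho.
have := normcB_le w (w - z); rewrite (_ : w - (w - z) = z); last by ring.
lra.
Qed.

(** The disc is a closed subset of the continuous image of a compact real square. *)
Lemma compact_disc rho : compact (disc rho).
Proof.
pose F (p : R * R) : R[i]^o := p.1 +i* p.2.
have cF : continuous F.
  move=> p; apply/cvgrPdist_le => _ /gt0_complexP[e e0 ->].
  have e2 : 0 < e / 2 by rewrite divr_gt0.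
  exists ([set x | `|p.1 - x| <= e / 2], [set x | `|p.2 - x| <= e / 2]) => /=.
    by split; apply/nbhs_ballP; exists (e / 2) => // x; rewrite /ball/= => /ltW.
  case=> x y [/= hx hy]; rewrite normC_normc lecR.
  by apply: le_trans (normc_le_ReIm _) _; rewrite /=; lra.
have cpt : compact (F @` (`[- rho, rho] `*` `[- rho, rho])).
  apply: continuous_compact; first exact: continuous_subspaceT.
  by apply: compact_setX; exact: segment_compact.
apply: subclosed_compact cpt _; first exact: closed_disc.
move=> z zr; exists (complex.Re z, complex.Im z); last by case: z zr.
split; rewrite /= in_itv /= -ler_norml.
  exact: le_trans (Re_le_normc _) zr.
exact: le_trans (Im_le_normc _) zr.
Qed.

Lemma compact_bounded_by (A : set R[i]^o) f : compact A -> continuous f ->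
  exists K : R, forall z, A z -> normc (f z) <= K.
Proof.
move=> /compact_near_coveringP cA cf.
have [|n _ /(_ n (leqnn n)) H] := cA nat \oo (fun n z => normc (f z) <= n%:R) _.
  move=> z Az; have [e e0 sub] : exists2 e, 0 < e & forall w, normc (w - z) < e ->
      normc (f w) <= normc (f z) + 1.
    have fz : nbhs (f z) [set y | normc (y - f z) < 1].
      by apply/nbhs_complexP; exists 1.
    have /nbhs_complexP[e e0 sub] := cf z _ fz; exists e => // w /sub /= /ltW wz.
    by have := le_normcD (f w - f z) (f z); rewrite subrK; lra.
  exists ([set w | normc (w - z) < e], [set n | normc (f z) + 1 <= n%:R]) => /=.
    split; first by apply/nbhs_complexP; exists e.
    exists (Num.bound (normc (f z) + 1)) => // n /= bn.
    apply: le_trans (_ : (Num.bound (normc (f z) + 1))%:R <= _); last by rewrite ler_nat.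
    by apply/ltW/archi_boundP; rewrite addr_ge0 ?normc_ge0.
  by case=> w n [/= /sub h1 h2]; exact: le_trans h1 h2.
by exists n%:R => z /H.
Qed.

Lemma entire_bounded_on_disc f rho : entire R f ->
  exists K : R, forall z, normc z <= rho -> normc (f z) <= K.
Proof.
by move=> df; apply: compact_bounded_by (@compact_disc rho) (entire_continuous df).
Qed.

Lemma entire_lipschitz f rho : entire R f -> exists2 K : R, 0 < K &
  forall z w, normc z <= rho -> normc w <= rho ->
    normc (f z - f w) <= K * normc (z - w).
Proof.
move=> df; have [K HK] := entire_bounded_on_disc (rho + 1) df.
exists (`|2 * K| + 1); first by rewrite ltr_wpDl.
move=> z w zr wr; apply: le_trans (lipschitz_on_disc df HK zr wr) _.
by apply: ler_wpM2r; [exact: normc_ge0|have := ler_norm (2 * K); lra].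
Qed.

(** This replaces the topology by concrete neighbourhoods given by a disc and a tolerance; closed
    discs are compact, and every compact set lies in one. *)
Lemma nbhs_entireP (f : entire_space R) (U : set (entire_space R)) :
  nbhs f U <-> exists rho e, 0 < e /\ forall g : entire_space R,
    (forall z : R[i], normc z <= rho -> normc (set_val g z - set_val f z) <= e) -> U g.
Proof.
split=> [|[rho [e [e0 sub]]]]; last first.
  pose E := [set p : R[i]^o * R[i]^o | normc (p.2 - p.1) <= e].
  have entE : entourage E.
    rewrite -entourage_ballE; exists e%:C => /=; first by rewrite ltcR.
    by case=> x y; rewrite /ball /= normC_normc ltcR normc_distC => /ltW.
  have := fam_nbhs (set_val f : {family compact, R[i]^o -> R[i]^o}) entE
    (@compact_disc rho).
  move=> /(@initial_continuous (entire_space R) _ set_val f).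
  move=> near_f; apply: (@filterS _ (nbhs f) _ _ _ _ near_f) => g /= Hg.
  by apply: sub => z zr; exact: Hg.
rewrite /nbhs /= => -[V [/= [W oW <-] Wf WU]].
pose B (p : R * R) : set (R[i]^o -> R[i]^o) := [set g | forall z : R[i],
  normc z <= p.1 -> normc (g z - (set_val f : R[i]^o -> R[i]^o) z) <= p.2].
pose G := filter_from [set p : R * R | 0 < p.2] B.
have FG : Filter G.
  apply: filter_from_filter; first by exists (0, 1); exact: ltr01.
  move=> [r1 e1] [r2 e2] /= e10 e20; exists (Num.max r1 r2, Num.min e1 e2) => /=.
    by rewrite lt_min e10.
  move=> g Bg; split=> z zr; apply: le_trans (Bg z _) _; rewrite /= ?ge_min ?lexx ?orbT//.
  - by rewrite le_max zr.
  - by rewrite le_max zr orbT.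
(* The filter generated by the sets [B] converges to [f] uniformly on compact sets, so it contains
   every open set around [f]. *)
have Gf : {family compact, G --> (set_val f : R[i]^o -> R[i]^o)}.
  apply/fam_cvgP => A cA V' /uniform_nbhs[E [entE sub]].
  have [rho Hrho] := @compact_bounded_by A id cA (entire_continuous (entire_id R)).
  move: entE; rewrite -entourage_ballE => -[_/= /gt0_complexP[e e0 ->] subE].
  exists (rho, e / 2); first by rewrite /= divr_gt0.
  move=> g Bg; apply: sub => z Az; apply: subE; rewrite /ball /= normC_normc ltcR.
  by rewrite normc_distC; apply: le_lt_trans (Bg z (Hrho z Az)) _; rewrite /=; lra.
have [[rho e] /= e0 sub] : G W by apply: Gf; exact: open_nbhs_nbhs.
by exists rho, e; split => // g Hg; apply: WU; apply: sub.
Qed.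

End Topology.

(** * Approximation on one ring of discs *)

Section RingApproximation.
Variable R : realType.
Implicit Types (f p : R[i]^o -> R[i]^o) (c w y z zeta : R[i]).

Lemma norm_exp1D_sub1 zeta n : n%:R * normc zeta <= 1 / 2 ->
  normc ((1 + zeta) ^+ n - 1) <= 2 * n%:R * normc zeta.
Proof.
set x := normc zeta; have x0 : 0 <= x := normc_ge0 _.
elim: n => [|n IHn]; first by rewrite expr0 subrr normc0 mulr0 mul0r.
have nSR : n.+1%:R = n%:R + 1 :> R by rewrite natr1.
rewrite nSR => nx.
have n0 : 0 <= n%:R * x by rewrite mulr_ge0.
have {}IHn : normc ((1 + zeta) ^+ n - 1) <= 2 * n%:R * x by apply: IHn; lra.
have -> : (1 + zeta) ^+ n.+1 - 1 =
    ((1 + zeta) ^+ n - 1) + zeta * (1 + ((1 + zeta) ^+ n - 1)).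
  by rewrite exprS; ring.
apply: le_trans (le_normcD _ _) _; rewrite normcM -/x.
have := le_normcD 1 ((1 + zeta) ^+ n - 1); rewrite normc1 => H.
have : x * normc (1 + ((1 + zeta) ^+ n - 1)) <= x * 2 by apply: ler_wpM2l => //; lra.
lra.
Qed.

Lemma norm_exp1D_sub_affine zeta n : n%:R * normc zeta <= 1 / 2 ->
  normc ((1 + zeta) ^+ n - 1 - n%:R * zeta) <= (n%:R * normc zeta) ^+ 2.
Proof.
set x := normc zeta; have x0 : 0 <= x := normc_ge0 _.
elim: n => [|n IHn].
  by rewrite expr0 subrr !mul0r subr0 normc0 expr0n.
have nSR : n.+1%:R = n%:R + 1 :> R by rewrite natr1.
have nSC : n.+1%:R = n%:R + 1 :> R[i] by rewrite natr1.
rewrite nSR nSC => nx.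
have n0 : 0 <= n%:R * x by rewrite mulr_ge0.
have nx2 : n%:R * x <= 1 / 2 by lra.
have {}IHn := IHn nx2; have := norm_exp1D_sub1 nx2; rewrite -/x => H1.
have -> : (1 + zeta) ^+ n.+1 - 1 - (n%:R + 1) * zeta =
    ((1 + zeta) ^+ n - 1 - n%:R * zeta) + zeta * ((1 + zeta) ^+ n - 1).
  by rewrite exprS; ring.
apply: le_trans (le_normcD _ _) _; rewrite normcM -/x.
have := ler_wpM2l x0 H1; move: IHn; rewrite !expr2; nra.
Qed.

(* A polynomial substitute for Newton's step on [y ^+ N = 1]: its derivative vanishes
   at the N-th roots of unity. *)
Definition root_step N y : R[i] := y * (1 + (1 - y ^+ N) / N%:R).

(** The linear terms cancel: what remains is [E / N] and [zeta * (V / N)], of sizes [N * x ^ 2] and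
    [2 * x ^ 2], and [N * x] is small. *)
Lemma root_step_contract N zeta : (0 < N)%N -> N%:R * normc zeta <= 1 / 16 ->
  normc (root_step N (1 + zeta) - 1) <= normc zeta / 2.
Proof.
move=> N0; set x := normc zeta => Nx; have x0 : 0 <= x := normc_ge0 _.
have Nx2 : N%:R * normc zeta <= 1 / 2 by rewrite -/x; lra.
have N1 : 1 <= N%:R :> R by rewrite ler1n.
have NC : N%:R != 0 :> R[i] by rewrite pnatr_eq0 -lt0n.
have := norm_exp1D_sub1 Nx2; have := norm_exp1D_sub_affine Nx2; rewrite -/x.
set V := (1 + zeta) ^+ N - 1; set E := V - N%:R * zeta => EN VN.
have -> : root_step N (1 + zeta) - 1 = - (E / N%:R) - zeta * (V / N%:R).
  by rewrite /root_step /E /V; field.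
have NR : N%:R != 0 :> R by rewrite gt_eqF// (lt_le_trans ltr01).
apply: le_trans (normcB_le _ _) _.
rewrite normcN !normcM normcV (normc_natr R) -/x.
have h1 : normc E / N%:R <= N%:R * x ^+ 2.
  rewrite ler_pdivrMr ?(lt_le_trans ltr01)//; apply: le_trans EN _.
  by rewrite exprMn expr2; lra.
have h2 : x * (normc V / N%:R) <= x * (2 * x).
  apply: ler_wpM2l => //; rewrite ler_pdivrMr ?(lt_le_trans ltr01)//.
  by apply: le_trans VN _; lra.
have h3 : x <= 1 / 16 by apply: le_trans Nx; rewrite ler_peMl.
apply: le_trans (lerD h1 h2) _; rewrite expr2; nra.
Qed.

Lemma iter_root_step_contract N zeta n : (0 < N)%N -> N%:R * normc zeta <= 1 / 16 ->
  normc (iter n (root_step N) (1 + zeta) - 1) <= normc zeta / 2 ^+ n.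
Proof.
move=> N0 Nx; elim: n => [|n IHn]; first by rewrite expr0 divr1 /= addrC addKr.
rewrite iterS -[iter n _ _](subrKC 1).
apply: le_trans (root_step_contract N0 _) _.
  apply: le_trans Nx; rewrite ler_wpM2l//; apply: le_trans IHn _.
  rewrite ler_pdivrMr ?exprn_gt0// ler_peMr ?normc_ge0//.
  by rewrite exprn_ege1// ler1n.
rewrite exprS invfM mulrA mulrAC.
by rewrite ler_wpM2r.
Qed.

(** Equivariance under N-th roots of unity transfers the contraction near 1 to every root. *)
Lemma iter_root_step_rotate N w y n : w ^+ N = 1 ->
  iter n (root_step N) (w * y) = w * iter n (root_step N) y.
Proof.
move=> wN; elim: n => //= n ->.
by rewrite /root_step exprMn wN mul1r mulrA.
Qed.

Lemma entire_iter f n : entire R f -> entire R (iter n f).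
Proof.
move=> df; elim: n => [|n IHn]; first exact: entire_id.
exact: (entire_comp df IHn).
Qed.

Arguments entire_iter {f} n _ _.

Lemma entire_root_step N : entire R (root_step N).
Proof.
have dX := entireX N (entire_id R).
have d1 := entireD (entire_cst 1)
  (entireM (entireB (entire_cst 1) dX) (entire_cst N%:R^-1)).
exact: (entireM (entire_id R) d1).
Qed.

Arguments entire_root_step : clear implicits.

(* Both fixed points [0] and [1] are superattracting. *)
Definition smooth_step w : R[i] := w ^+ 2 * (3 - 2 * w).

Lemma entire_smooth_step : entire R smooth_step.
Proof.
have d2 := entireB (entire_cst 3) (entireM (entire_cst 2) (entire_id R)).
exact: (entireM (entireX 2 (entire_id R)) d2).
Qed.

Lemma iter_smooth_step_small w n : normc w <= 1 / 8 ->
  normc (iter n smooth_step w) <= (2 ^+ n)^-1.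
Proof.
move=> w8; suff : normc (iter n smooth_step w) <= normc w / 2 ^+ n.
  move=> H; apply: le_trans H _; rewrite ler_piMl ?invr_ge0 ?exprn_ge0//; lra.
elim: n => [|n IHn]; first by rewrite expr0 divr1.
rewrite iterS; set v := iter n _ _ in IHn *.
have v8 : normc v <= 1 / 8.
  apply: le_trans IHn (le_trans _ w8); rewrite ler_piMr ?normc_ge0//.
  by rewrite invf_le1 ?exprn_gt0// exprn_ege1// ler1n.
rewrite exprS invfM mulrA mulrAC; apply: le_trans (_ : normc v / 2 <= _); last first.
  by rewrite ler_wpM2r.
rewrite normcM normc_exp expr2 -mulrA.
apply: ler_wpM2l; first exact: normc_ge0.
have := normcB_le 3 (2 * v); rewrite normcM !(normc_natr R).
have := normc_ge0 v; have := normc_ge0 (3 - 2 * v); nra.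
Qed.

(** This symmetry turns attraction to 0 into attraction to 1. *)
Lemma smooth_step_compl w : smooth_step (1 - w) = 1 - smooth_step w.
Proof. by rewrite /smooth_step; ring. Qed.

Lemma iter_smooth_step_compl w n :
  iter n smooth_step (1 - w) = 1 - iter n smooth_step w.
Proof. by elim: n => //= n ->; rewrite smooth_step_compl. Qed.

(* The entire function [Y z = c * iter n (root_step N) (z / c)] is close to [c']
   on each disc around an N-th root [c'] of [c ^+ N], and the cut-off
   [h = iter m smooth_step ((z / c) ^+ N)] is close to [1] there and to [0] on the
   central disc; take [F z = f z + h z * (p (z - Y z) - f z)]. *)
Lemma ring_approximation f p c (N : nat) (rad b eps : R) :
    entire R f -> entire R p -> (0 < N)%N -> c != 0 -> 0 < eps ->
    16 * N%:R * rad <= normc c -> (b / normc c) ^+ N <= 1 / 8 ->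
  exists F, [/\ entire R F,
    forall z, normc z <= b -> normc (F z - f z) <= eps &
    forall c' z, c' ^+ N = c ^+ N -> normc (z - c') <= rad ->
      normc (F z - p (z - c')) <= eps].
Proof.
move=> df dp N0 c0 eps0 Nrad b8.
have nc0 : 0 < normc c by rewrite normc_gt0.
have NR : 1 <= N%:R :> R by rewrite ler1n.
have [K K0 Kp] := entire_lipschitz (2 * rad) dp.
have e2 : 0 < eps / 2 by rewrite divr_gt0.
(* With this [n], replacing [Y z] by [c'] changes the value of [p] by at most [eps / 2]. *)
have [n Hn] := geometric_small (K * rad) e2.
pose Y z : R[i] := c * iter n (root_step N) (z / c).
have dscale : entire R (fun z : R[i] => z / c) := entireM (entire_id R) (entire_cst c^-1).
have dY : entire R Y.
  have dI := entire_comp (entire_iter n (entire_root_step N)) dscale.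
  exact: (entireM (entire_cst c) dI).
have Y_near c' z : c' ^+ N = c ^+ N -> normc (z - c') <= rad ->
    [/\ normc c' = normc c, normc (Y z - c') <= normc (z - c') / 2 ^+ n &
        normc (1 - (z / c) ^+ N) <= 1 / 8].
  move=> c'N zc'.
  have nc' : normc c' = normc c.
    apply: (pexpIrn N0); rewrite ?nnegrE ?normc_ge0//.
    by rewrite -!normc_exp c'N.
  have c'0 : c' != 0 by rewrite -normc_gt0 nc'.
  (* Relative to [c], the point [z] is an N-th root of unity [w] times a point near 1. *)
  pose w := c' / c; pose zeta := (z - c') / c'.
  have zE : z / c = w * (1 + zeta) by rewrite /w /zeta; field; rewrite c'0.
  have wN : w ^+ N = 1 by rewrite exprMn exprVn c'N divff// expf_neq0.
  have nzeta : normc zeta = normc (z - c') / normc c.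
    by rewrite normcM normcV nc'.
  have Nz : N%:R * normc zeta <= 1 / 16.
    rewrite nzeta mulrA ler_pdivrMr//.
    have : N%:R * normc (z - c') <= N%:R * rad by rewrite ler_wpM2l.
    lra.
  split=> //.
    have -> : Y z - c' = c' * (iter n (root_step N) (1 + zeta) - 1).
      rewrite /Y zE iter_root_step_rotate// mulrBr mulr1 mulrA /w.
      by rewrite mulrCA divff// mulr1.
    rewrite normcM nc'.
    apply: le_trans (ler_wpM2l (ltW nc0) (iter_root_step_contract n N0 Nz)) _.
    by rewrite nzeta mulrA mulrCA divff ?gt_eqF// mulr1.
  rewrite zE exprMn wN (mul1r ((1 + zeta) ^+ N)) normc_distC.
  have Nz2 : N%:R * normc zeta <= 1 / 2 by lra.
  by apply: le_trans (norm_exp1D_sub1 Nz2) _; rewrite -mulrA; lra.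
pose G z := p (z - Y z) - f z.
have dG : entire R G := entireB (entire_comp dp (entireB (entire_id R) dY)) df.
(* This disc contains both the inner disc and the ring; [m] then makes the cut-off error at most
   [eps / 2] on either. *)
have [B HB] := entire_bounded_on_disc (Num.max b (normc c + rad)) dG.
have [m Hm] := geometric_small B e2.
pose h z : R[i] := iter m smooth_step ((z / c) ^+ N).
have dh : entire R h := entire_comp (entire_iter m entire_smooth_step) (entireX N dscale).
have small_hG (x z : R[i]) : normc x <= (2 ^+ m)^-1 ->
    normc z <= Num.max b (normc c + rad) -> normc (x * G z) <= eps / 2.
  move=> xm /HB GB; rewrite normcM mulrC; apply: le_trans (ltW Hm).
  by apply: ler_pM => //; exact: normc_ge0.
exists (fun z => f z + h z * G z); split.
- exact: (entireD df (entireM dh dG)).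
- move=> z zb; rewrite addrC addKr; apply: le_trans (small_hG _ _ _ _) _.
  + apply: iter_smooth_step_small; rewrite normc_exp normcM normcV.
    apply: le_trans b8; rewrite lerXn2r ?nnegrE ?divr_ge0 ?normc_ge0//.
      exact: le_trans (normc_ge0 _) zb.
    by rewrite ler_wpM2r// invr_ge0 ltW.
  + by rewrite le_max zb.
  + by lra.
- move=> c' z c'N zc'; have [nc' Yc' h1] := Y_near c' z c'N zc'.
  have r0 : 0 <= rad := le_trans (normc_ge0 _) zc'.
  have -> : f z + h z * G z - p (z - c') =
     (p (z - Y z) - p (z - c')) - (1 - h z) * G z by rewrite /G; ring.
  apply: le_trans (normcB_le _ _) _; rewrite [leRHS]splitr; apply: lerD.
    have Yr : normc (Y z - c') <= rad / 2 ^+ n.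
      by apply: le_trans Yc' _; rewrite ler_wpM2r// invr_ge0 exprn_ge0.
    have Yr1 : rad / 2 ^+ n <= rad.
      by rewrite ler_piMr// invf_le1 ?exprn_gt0// exprn_ege1// ler1n.
    apply: le_trans (Kp _ _ _ _) _.
    + have -> : z - Y z = (z - c') - (Y z - c') by ring.
      by apply: le_trans (normcB_le _ _) _; lra.
    + by lra.
    + have -> : z - Y z - (z - c') = - (Y z - c') by ring.
      rewrite normcN; apply: le_trans (ltW Hn).
      by rewrite -mulrA ler_wpM2l// ltW.
  apply: small_hG.
    by rewrite -iter_smooth_step_compl; exact: iter_smooth_step_small.
  rewrite le_max; apply/orP; right.
  by rewrite -[z](subrK c') addrC -nc'; apply: le_trans (le_normcD _ _) _; rewrite lerD2l.
Qed.

End RingApproximation.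

(** * Auxiliary estimates for the covering, and approximation on several rings *)

Section Covering.
Variable R : realType.
Implicit Types (f p : R[i]^o -> R[i]^o) (a z u : R[i]).

(** If all finite sums stayed below [A], so would the series, and the supremum over the tail from
    [n1] on would bound the limit superior. This makes the divergence condition a finite one. *)
Lemma limn_esup_series_pinfty (m : nat -> R) (n1 : nat) (A : R) :
    (forall n, (n1 <= n)%N -> 0 < m n) ->
    limn_esup (fun n => (m n)%:E * \sum_(n <= k <oo) ((m k)^-1)%:E)%E = +oo%E ->
  exists n L, (n1 <= n)%N /\ A <= m n * \sum_(n <= k < n + L) (m k)^-1.
Proof.
move=> m_gt0 esup_oo; apply/not_existsP => no_n.
suff : (limn_esup (fun n => (m n)%:E * \sum_(n <= k <oo) ((m k)^-1)%:E) <= A%:E)%E.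
  by rewrite esup_oo leye_eq.
apply: le_trans (_ : (ereal_sup ((fun n => (m n)%:E * \sum_(n <= k <oo) ((m k)^-1)%:E)
    @` [set n | (n1 <= n)%N]) <= _)%E).
  by apply: ereal_inf_lbound; exists [set n | (n1 <= n)%N] => //; exists n1.
apply: ge_ereal_sup => _ [n /= n1n <-].
have mn := m_gt0 n n1n.
have mk k : (n <= k)%N -> (0 <= ((m k)^-1)%:E)%E.
  by move=> nk; rewrite lee_fin invr_ge0 ltW// m_gt0// (leq_trans n1n).
suff H : (\sum_(n <= k <oo) ((m k)^-1)%:E <= (A / m n)%:E)%E.
  apply: le_trans (lee_wpmul2l _ H) _; first by rewrite lee_fin ltW.
  by rewrite -EFinM mulrC divfK// gt_eqF.
apply: lime_le; first by apply: is_cvg_nneseries => k nk _; exact: mk.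
exists n => // k /= nk; rewrite sumEFin lee_fin ler_pdivlMr// mulrC leNgt.
apply/negP => lt_A; apply: (no_n n); exists (k - n)%N; split=> //.
by rewrite subnKC// ltW.
Qed.

Lemma half_integer_part (x : R) : 1 <= x -> exists2 n : nat, n%:R <= x & x / 2 <= n%:R.
Proof.
move=> x1; have x0 : 0 <= x by lra.
have /andP[tx xt] := truncn_itv x0; exists (Num.truncn x) => //.
have [t0|t0] := posnP (Num.truncn x).
  by move: xt; rewrite t0; lra.
have : 1 <= (Num.truncn x)%:R :> R by rewrite ler1n.
move: xt; rewrite -natr1; lra.
Qed.

(** A Bernoulli-type bound, used below with [n * t = 7] to obtain [1 / 8]. *)
Lemma exp_compl_le (t : R) n : 0 <= t <= 1 -> (1 - t) ^+ n * (1 + n%:R * t) <= 1.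
Proof.
move=> /andP[t0 t1]; elim: n => [|n IHn]; first by rewrite expr0 mul0r addr0 mulr1.
apply: le_trans IHn; rewrite exprSr -mulrA ler_wpM2l ?exprn_ge0 ?subr_ge0//.
have nS : n.+1%:R = n%:R + 1 :> R by rewrite natr1.
by rewrite nS; have := ler0n R n; nra.
Qed.

(** The angle is taken nonnegative, so that whole sectors below it can be counted; below the real
    axis it is [2 * pi - acos x]. *)
Lemma polar_form u : normc u = 1 ->
  exists2 t : R, 0 <= t & u = cexp ('i * t%:C).
Proof.
case: u => x y nu.
have xy : x ^+ 2 + y ^+ 2 = 1.
  have := congr1 (fun s : R => s ^+ 2) nu; rewrite /= expr1n sqr_sqrtr//.
  by rewrite addr_ge0 ?sqr_ge0.
have x1 : -1 <= x <= 1 by rewrite -ler_norml -nu; exact: (Re_le_normc (x +i* y)).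
have [/andP[a0 api] ca] := acos_def x1.
have yE : sin (acos x) = `|y|.
  by rewrite sin_acos// -xy addrC addKr sqrtr_sqr.
have iE (t : R) : 'i * t%:C = 0 +i* t by simpc.
have [y0|y0] := leP 0 y.
  exists (acos x) => //.
  by rewrite iE cexpE expR0 !mul1r ca yE ger0_norm.
exists (- acos x + pi *+ 2); first by rewrite mulr2n; lra.
rewrite iE cexpE expR0 !mul1r cosD2pi sinD2pi cosN sinN ca yE.
by rewrite ltr0_norm// opprK.
Qed.

Lemma cexp_i_lipschitz (s t : R) :
  normc (cexp ('i * s%:C) - cexp ('i * t%:C)) <= `|s - t|.
Proof.
have -> : `|s - t| = 1 * normc ('i * s%:C - 'i * t%:C).
  by rewrite -mulrBr normcM normc_i !mul1r -rmorphB normc_real.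
apply: (segment_mean_value (@cderiv_cexp R)) => x _.
rewrite normc_cexp (_ : complex.Re _ = 0) ?expR0//.
by simpc.
Qed.

(** Rings are added from the inside outwards: the inner disc of each ring contains all earlier
    rings, so a correction of size [eps / 2] there preserves what was achieved with [eps / 2]. *)
Lemma rings_approximation f p (c : nat -> R[i]) (N : nat -> nat) (b : nat -> R)
    (rho rad : R) : entire R f -> entire R p ->
    (forall j, (0 < N j)%N) -> (forall j, c j != 0) ->
    (forall j, 16 * (N j)%:R * rad <= normc (c j)) ->
    (forall j, (b j / normc (c j)) ^+ N j <= 1 / 8) ->
    (forall j, rho <= b j) ->
    (forall i j, (i < j)%N -> normc (c i) + rad <= b j) ->
  forall L (eps : R), 0 < eps -> exists F, [/\ entire R F,
    forall z, normc z <= rho -> normc (F z - f z) <= eps &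
    forall j c' z, (j < L)%N -> c' ^+ N j = c j ^+ N j -> normc (z - c') <= rad ->
      normc (F z - p (z - c')) <= eps].
Proof.
move=> df dp N0 c0 Nrad b8 rho_b c_b.
elim=> [|L IHL] eps eps0.
  by exists f; split=> // z _; rewrite subrr normc0 ltW.
have e2 : 0 < eps / 2 by rewrite divr_gt0.
have [F [dF Ff Fp]] := IHL _ e2.
have [G [dG GF Gp]] := ring_approximation dF dp (N0 L) (c0 L) e2 (Nrad L) (b8 L).
exists G; split=> //.
  move=> z zr; apply: le_trans (normc_dist_triangle (F z) _ _) _.
  have := Ff z zr; have := GF z (le_trans zr (rho_b L)); lra.
move=> j c' z; rewrite ltnS leq_eqVlt => /orP[/eqP->|jL] c'N zc'.
  by apply: le_trans (Gp _ _ c'N zc') _; lra.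
apply: le_trans (normc_dist_triangle (F z) _ _) _.
have h1 := Fp _ _ _ jL c'N zc'.
have zb : normc z <= b L.
  apply: le_trans (c_b _ _ jL).
  have -> : normc (c j) = normc c'.
    by apply: (pexpIrn (N0 j)); rewrite ?nnegrE ?normc_ge0// -!normc_exp c'N.
  have := le_normcD c' (z - c'); rewrite (_ : c' + (z - c') = z); last by ring.
  lra.
have := GF z zb; lra.
Qed.

End Covering.

(** * Choice of the rings and covering of all directions *)

Section CircleApproximation.
Variable R : realType.
Implicit Types (f p : R[i]^o -> R[i]^o) (a z : R[i]).

Lemma discrete_bracket (g : nat -> R) (x : R) L : g 0 <= x -> x < g L ->
  exists2 j, (j < L)%N & g j <= x < g j.+1.
Proof.
elim: L => [|L IHL] g0; first by rewrite ltNge g0.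
have [xL|Lx] := ltP x (g L); last by move=> xSL; exists L; rewrite ?Lx.
by have [j jL gj] := IHL g0 xL => _; exists j => //; exact: ltnW.
Qed.

(* The number of discs on the circle of radius [radii j] is a multiple [N * q j] of
   [N], of order [radii j / rad]: few enough for [ring_approximation], and many
   enough for the central disc of radius [b j] to reach the previous circle. *)
Lemma level_counts (radii : nat -> R) (rad rho : R) : 0 < rad ->
    (forall i j, (i < j)%N -> radii i + 225 * rad <= radii j) ->
    `|rho| + 224 * rad <= radii 0 ->
  exists (N : nat) (q : nat -> nat) (b : nat -> R),
    [/\ (0 < N)%N /\ radii 0 <= 32 * rad * N%:R,
        forall j, (0 < N * q j)%N /\ 16 * (N * q j)%:R * rad <= radii j,
        forall j, (b j / radii j) ^+ (N * q j) <= 1 / 8,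
        forall j, rho <= b j &
        forall i j, (i < j)%N -> radii i + rad <= b j].
Proof.
move=> rad0 gap rho0.
have radii0 j : radii 0 <= radii j.
  by case: j => // j; have := gap 0 j.+1 isT; lra.
have r16 : 0 < 16 * rad by rewrite pmulr_rgt0 ?ltr0n.
have nrho := normr_ge0 rho.
(* The upper bound on [N] is what [ring_approximation] requires; rounding down loses at most a
   factor two, whence 32. *)
have [|N N_le N_ge] := @half_integer_part R (radii 0 / (16 * rad)).
  by rewrite ler_pdivlMr// mul1r; lra.
have {}N_le : 16 * rad * N%:R <= radii 0.
  by move: N_le; rewrite ler_pdivlMr// mulrC.
have {}N_ge : radii 0 <= 32 * rad * N%:R.
  by move: N_ge; rewrite -mulrA -invfM ler_pdivrMr ?mulr_gt0//; lra.
have N7 : 7 <= N%:R :> R by nra.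
have N_gt0 : 0 < N%:R :> R by lra.
have rN : 0 < 16 * rad * N%:R by rewrite mulr_gt0.
have /choice[q qP] j : exists n : nat, 16 * (N * n)%:R * rad <= radii j /\
    radii j <= 32 * rad * (N * n)%:R.
  have [|n n_le n_ge] := @half_integer_part R (radii j / (16 * rad * N%:R)).
    by rewrite ler_pdivlMr// mul1r; exact: le_trans (radii0 j).
  exists n; rewrite natrM; split.
    by move: n_le; rewrite ler_pdivlMr// => n_le; lra.
  by move: n_ge; rewrite -mulrA -invfM ler_pdivrMr ?mulr_gt0//; lra.
have NN7 j : 7 <= (N * q j)%:R :> R.
  have [_ q2] := qP j; have := radii0 j => r0j.
  by set t := (N * q j)%:R in q2 *; nra.
have NN0 j : 0 < (N * q j)%:R :> R by apply: lt_le_trans (NN7 j); rewrite ltr0n.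
have radii_gt0 j : 0 < radii j by have := radii0 j; lra.
(* With [t = 7 / (N * q j)], [exp_compl_le] gives [1 / (1 + 7)], while [b j] stays within
   [7 * 32 * rad = 224 * rad] of the circle; the gap of [225 * rad] leaves one more [rad] for the
   discs. *)
pose b j : R := radii j * (1 - 7 / (N * q j)%:R).
have b_ge j : radii j - 224 * rad <= b j.
  have [_ q2] := qP j; rewrite /b mulrBr mulr1 lerD2l lerN2.
  by rewrite mulrA ler_pdivrMr//; lra.
exists N, q, b; split.
- by rewrite -(ltr0n R).
- by move=> j; rewrite -(ltr0n R); have [] := qP j.
- move=> j; rewrite /b mulrC mulKf ?gt_eqF// ler_pdivlMr ?ltr0n//.
  have := @exp_compl_le R (7 / (N * q j)%:R) (N * q j).
  rewrite [_ * (7 / _)]mulrC divfK ?gt_eqF// => H.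
  rewrite (_ : 8 = 1 + 7); last by ring.
  by apply: H; rewrite ler_pdivrMr// mul1r NN7 andbT divr_ge0 ?ler0n.
- by move=> j; have := b_ge j; have := radii0 j; have := ler_norm rho; lra.
- by move=> i j /gap; have := b_ge j; lra.
Qed.

(* Level [j] takes care of the angles in [alpha j, alpha j.+1] modulo [2 pi / N], so
   the levels below [L] exhaust the circle once [alpha L] exceeds [2 pi / N]. *)
Lemma angle_covering (alpha : nat -> R) (N L : nat) (r : R) a :
    0 < r -> (0 < N)%N -> alpha 0 = 0 -> 2 * pi / N%:R <= alpha L ->
    normc a = r ->
  exists j a', [/\ (j < L)%N, normc (a - a') <= r * (alpha j.+1 - alpha j) &
    forall q, a' ^+ (N * q) = (r%:C * cexp ('i * (alpha j)%:C)) ^+ (N * q)].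
Proof.
rewrite -(ltr0n R) => r0 N0 alpha0 alphaL na.
have nrC : normc r%:C = r by rewrite normc_real gtr0_norm.
have rC0 : r%:C != 0 by rewrite -normc_gt0 nrC.
have [|theta theta0 uE] := @polar_form R (a / r%:C).
  by rewrite normcM normcV na nrC divff// gt_eqF.
have aE : a = r%:C * cexp ('i * theta%:C) by rewrite -uE mulrC divfK.
pose w : R := 2 * pi / N%:R.
have w0 : 0 < w by rewrite divr_gt0// mulr_gt0 ?pi_gt0.
have tw0 : 0 <= theta / w by rewrite divr_ge0// ltW.
have /andP[s1 s2] := truncn_itv tw0.
set s := Num.truncn _ in s1 s2.
have {}s1 : s%:R * w <= theta by rewrite -ler_pdivlMr.
have {}s2 : theta < (s%:R + 1) * w by rewrite -ltr_pdivrMr// natr1.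
have [||j jL /andP[aj1 aj2]] := @discrete_bracket alpha (theta - s%:R * w) L.
- by rewrite alpha0 subr_ge0.
- by apply: lt_le_trans alphaL; rewrite -/w; lra.
(* The [s] whole sectors removed from the angle are put back; they amount to an N-th root of unity,
   which exponents [N * q] do not see. *)
exists j, (r%:C * cexp ('i * (alpha j + s%:R * w)%:C)); split=> //.
  rewrite aE -mulrBr normcM nrC ler_wpM2l ?(ltW r0)//.
  apply: le_trans (cexp_i_lipschitz _ _) _.
  rewrite (_ : theta - _ = theta - s%:R * w - alpha j); last by ring.
  by rewrite ger0_norm ?subr_ge0//; lra.
move=> q; have NC : N%:R != 0 :> R[i] by rewrite -normc_gt0 normc_natr.
have root1 : cexp ('i * (s%:R * w)%:C) ^+ (N * q) = 1.
  rewrite exprM -cexp_nat.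
  have -> : N%:R * ('i * (s%:R * w)%:C) = s%:R * ('i * (2 * pi : R)%:C).
    by rewrite /w !rmorphM fmorphV !rmorph_nat; field.
  by rewrite cexp_nat cexp_2pi !expr1n.
rewrite rmorphD mulrDr cexpD [r%:C * _]mulrA exprMn root1.
by rewrite mulr1.
Qed.

Lemma gap_growth (m : nat -> R) (g : R) : 0 <= m 0 ->
  (forall n, m n + g <= m n.+1) -> forall n, g * n%:R <= m n.
Proof.
move=> m0 gap; elim=> [|n IHn]; first by rewrite mulr0.
have nS : n.+1%:R = n%:R + 1 :> R by rewrite natr1.
by have := gap n; rewrite nS; lra.
Qed.

Lemma gap_lt (m : nat -> R) (g : R) : 0 <= g ->
  (forall n, m n + g <= m n.+1) -> forall i j, (i < j)%N -> m i + g <= m j.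
Proof.
move=> g0 gap i; elim=> // j IHj; rewrite ltnS leq_eqVlt => /orP[/eqP ->//|/IHj].
by have := gap j; lra.
Qed.

(** For each [a] some nearby [a'] makes [mu (n0 + j) * a'] a centre on level [j]; translating [F] by
    [mu (n0 + j) * a] then gives [p] up to a shift of size at most [delta]. *)
Lemma circle_approximation (lambda : nat -> R[i])
    (lambda_sub : forall M : R, 0 < M ->
      exists (phi : nat -> nat) (mu : nat -> R[i]),
        [/\ {homo phi : m n / (m < n)%N},
            mu = lambda \o phi,
            forall n, M < normc (mu n.+1) - normc (mu n) &
            limn_esup (fun n => (normc (mu n))%:E *
              \sum_(n <= k <oo) ((normc (mu k))^-1)%:E)%E = +oo%E])
    f p (r rho k eps : R) : 0 < r -> entire R f -> entire R p -> 0 < eps ->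
  exists F, [/\ entire R F,
    forall z, normc z <= rho -> normc (F z - f z) <= eps &
    forall a, normc a = r -> exists n, forall z, normc z <= k ->
      normc (F (z + lambda n * a) - p z) <= eps].
Proof.
move=> r0 df dp eps0; pose rad := `|k| + 1.
have rad1 : 1 <= rad by rewrite lerDr.
have rad0 : 0 < rad := lt_le_trans ltr01 rad1.
have g0 : 0 < 225 * rad by rewrite pmulr_rgt0 ?ltr0n.
have [K K0 Kp] := entire_lipschitz rad dp.
(* A shift by [delta] keeps the discs of radius [k] inside those of radius [rad] and changes [p]
   there by at most [eps / 2]. *)
pose delta := Num.min 1 (eps / (2 * K)).
have delta0 : 0 < delta by rewrite lt_min ltr01 divr_gt0// mulr_gt0.
have delta1 : delta <= 1 by rewrite ge_min lexx.
have deltaK : K * delta <= eps / 2.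
  rewrite mulrC -ler_pdivlMr//; have -> : eps / 2 / K = eps / (2 * K).
    by field; rewrite gt_eqF.
  by rewrite ge_min lexx orbT.
have [phi [mu [_ muE gap esup_oo]]] := lambda_sub _ (divr_gt0 g0 r0).
pose m n : R := normc (mu n).
have {}gap n : r * m n + 225 * rad <= r * m n.+1.
  rewrite -lerBrDl -mulrBr [leRHS]mulrC -ler_pdivrMr//; exact: ltW (gap n).
(* From this index on, the circles are large enough for their inner discs to contain the disc of
   radius [rho]. *)
pose n1 := (Num.bound (`|rho| + 224 * rad)).+1.
have bound0 : 0 <= `|rho| + 224 * rad.
  by apply: addr_ge0; [exact: normr_ge0|apply: mulr_ge0; [exact: ler0n|exact: ltW]].
have rho_le n : (n1 <= n)%N -> `|rho| + 224 * rad <= r * m n.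
  move=> n1n; have := gap_growth (mulr_ge0 (ltW r0) (normc_ge0 _)) gap n.
  apply: le_trans; apply: (@le_trans _ _ n%:R).
    apply: le_trans (ltW (archi_boundP bound0)) _.
    by rewrite ler_nat; exact: leq_trans (leqnSn _) n1n.
  by rewrite ler_peMl// (le_trans rad1)// ler_peMl ?ler1n// ltW.
have m_gt0 n : (n1 <= n)%N -> 0 < m n.
  move=> /rho_le H; rewrite -(pmulr_rgt0 _ r0); apply: lt_le_trans H.
  by apply: ltr_wpDl; [exact: normr_ge0|apply: mulr_gt0; [exact: ltr0n|]].
(* A first-level sector has angle [2 * pi / N], at most [64 * pi * rad / (r * m n0)]; the bound on
   the sum says exactly that [alpha L] reaches this angle. *)
have [n0 [L [n10 sum_ge]]] :=
  limn_esup_series_pinfty (64 * pi * rad / delta) m_gt0 esup_oo.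
pose radii j := r * m (n0 + j)%N.
have m_pos j : 0 < m (n0 + j)%N by rewrite m_gt0// (leq_trans n10)// leq_addr.
have radii_gt0 j : 0 < radii j by rewrite mulr_gt0.
have radii_gap i j : (i < j)%N -> radii i + 225 * rad <= radii j.
  by move=> ij; apply: (gap_lt (ltW g0) gap); rewrite ltn_add2l.
have rho0 : `|rho| + 224 * rad <= radii 0 by rewrite /radii addn0 rho_le.
have [N [q [b [[N0 N_ge] NN b8 rho_b b_gap]]]] := level_counts rad0 radii_gap rho0.
(* The angular step on level [j] corresponds to an arc of length [delta] on the circle of radius
   [radii j]. *)
pose alpha j : R := delta / r * \sum_(n0 <= i < n0 + j) (m i)^-1.
have alpha0 : alpha 0 = 0 by rewrite /alpha addn0 big_geq// mulr0.
have alphaS j : r * (alpha j.+1 - alpha j) = delta / m (n0 + j)%N.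
  rewrite /alpha addnS big_nat_recr ?leq_addr//=.
  by set S := \sum_(_ <= _ < _) _; field; rewrite !gt_eqF.
have alphaL : 2 * pi / N%:R <= alpha L.
  rewrite ler_pdivrMr ?ltr0n// -(ler_pM2l (radii_gt0 0)).
  apply: (@le_trans _ _ (32 * rad * N%:R * (2 * pi))).
    by rewrite ler_wpM2r// mulr_ge0 ?pi_ge0.
  rewrite (_ : 32 * rad * N%:R * (2 * pi) = 64 * pi * rad * N%:R); last by ring.
  rewrite [leRHS]mulrA ler_wpM2r ?ler0n//.
  rewrite ler_pdivrMr// in sum_ge; apply: le_trans sum_ge _.
  rewrite /radii /alpha addn0 le_eqVlt; apply/orP; left; apply/eqP.
  by field; rewrite gt_eqF.
pose c j : R[i] := mu (n0 + j)%N * (r%:C * cexp ('i * (alpha j)%:C)).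
have normc_c j : normc (c j) = radii j.
  rewrite normcM (normcM r%:C) normc_cexp (_ : complex.Re _ = 0); last by simpc.
  by rewrite expR0 mulr1 normc_real gtr0_norm// mulrC.
have [||||||F [dF Ff Fp]] := @rings_approximation R f p c (fun j => N * q j)%N b
    rho rad df dp _ _ _ _ _ _ L _ (divr_gt0 eps0 (ltr0n R 2)).
- by move=> j; have [] := NN j.
- by move=> j; rewrite -normc_gt0 normc_c.
- by move=> j; rewrite normc_c; have [] := NN j.
- by move=> j; rewrite normc_c.
- exact: rho_b.
- by move=> i j /b_gap; rewrite normc_c.
have le_half : eps / 2 <= eps.
  by apply: ler_piMr; [exact: ltW|rewrite invf_le1 ?ltr0n// ler1n].
exists F; split=> //.
  by move=> z /Ff zr; exact: le_trans zr le_half.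
move=> a na; have [j [a' [jL aa' a'N]]] := angle_covering r0 N0 alpha0 alphaL na.
pose w := mu (n0 + j)%N * (a - a').
have nw : normc w <= delta.
  rewrite normcM -/(m _) mulrC -ler_pdivlMr//.
  by apply: le_trans aa' _; rewrite alphaS.
exists (phi (n0 + j)%N) => z zk.
have -> : lambda (phi (n0 + j)%N) = mu (n0 + j)%N by rewrite muE.
have {}zk : normc z <= `|k| := le_trans zk (ler_norm _).
have xc' : z + mu (n0 + j)%N * a - mu (n0 + j)%N * a' = z + w by rewrite /w; ring.
have nzw : normc (z + w) <= rad.
  by apply: le_trans (le_normcD _ _) (lerD zk (le_trans nw delta1)).
have c'N : (mu (n0 + j)%N * a') ^+ (N * q j) = c j ^+ (N * q j).
  by rewrite exprMn a'N -exprMn.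
have := Fp j _ (z + mu (n0 + j)%N * a) jL c'N; rewrite xc' => /(_ nzw) h1.
have zrad : normc z <= rad by apply: le_trans zk _; rewrite lerDl.
have := Kp _ _ nzw zrad; rewrite (_ : z + w - z = w); last by ring.
move=> h2; have h3 := le_trans (ler_wpM2l (ltW K0) nw) deltaK.
rewrite [eps]splitr; apply: le_trans (normc_dist_triangle (p (z + w)) _ _) _.
exact: lerD h1 (le_trans h2 h3).
Qed.

End CircleApproximation.

(** * A dense sequence of entire functions and a Baire argument *)

Section Hypercyclic.
Variable R : realType.
Implicit Types (g p : R[i]^o -> R[i]^o) (a z : R[i]) (f : entire_space R).

Definition of_entire g (dg : entire R g) : entire_space R := SigSub (mem_set dg).

Lemma of_entireE g (dg : entire R g) z : set_val (of_entire dg) z = g z.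
Proof. by []. Qed.

Lemma translationE (b : R[i]) f z : set_val (translation b f) z = set_val f (z + b).
Proof. by []. Qed.

Lemma dense_sequence_complex : exists x : nat -> R[i],
  forall z (e : R), 0 < e -> exists i, normc (z - x i) < e.
Proof.
pose x (i : nat) : R[i] :=
  if unpickle i is Some (s, t) then ratr s +i* ratr t else 0 : R[i].
exists x => -[u v] e e0; have e2 : 0 < e / 2 by rewrite divr_gt0.
have near_rat (w : R) : exists q : rat, `|w - ratr q| < e / 2.
  have [|q] := @rat_in_itvoo R (w - e / 2) (w + e / 2); first by lra.
  rewrite in_itv /= => /andP[q1 q2]; exists q; rewrite ltr_norml; lra.
have [s us] := near_rat u; have [t vt] := near_rat v.
exists (pickle (s, t)); rewrite /x pickleK.
by apply: le_lt_trans (normc_le_ReIm _) _; rewrite /=; lra.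
Qed.

(* A bound and approximate values at finitely many points determine an entire
   function up to a small error, as the bound controls the modulus of continuity;
   the sequence picks one function for each such datum. *)
Lemma dense_sequence_entire : exists p : nat -> R[i]^o -> R[i]^o,
  (forall i, entire R (p i)) /\
  forall g (rho e : R), entire R g -> 0 < e ->
    exists i, forall z, normc z <= rho -> normc (g z - p i z) <= e.
Proof.
have [x xP] := dense_sequence_complex.
(* A datum is a bound, a radius, a precision and a list of indices of approximate values. Of the two
   extra units of radius, one is for net points outside the disc and one for Cauchy's estimate. *)
pose fits (d : nat * nat * nat * seq nat) g := let: (B, k, m, v) := d in
  [/\ entire R g, forall z, normc z <= k%:R + 2 -> normc (g z) <= B%:R &
    forall i, (i < size v)%N -> normc (g (x i) - x (nth 0 v i)) <= m.+1%:R^-1].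
have /choice[sel selP] d : exists g, entire R g /\ ((exists g', fits d g') -> fits d g).
  have [[g gd]|no_g] := pselect (exists g', fits d g').
    by exists g; split; [case: d gd => [[[B k] m] v] []|].
  by exists (fun=> 0); split; [exact: (entire_cst 0)|move/no_g].
pose p i := if unpickle i is Some d then sel d else fun=> 0.
exists p; split=> [i|g rho e dg e0].
  rewrite /p; case: (unpickle i) => [d|]; last exact: (entire_cst 0).
  by have [] := selP d.
pose k := Num.bound `|rho|.
have rhok : rho <= k%:R.
  by apply: le_trans (ler_norm _) (ltW (archi_boundP _)); exact: normr_ge0.
have [K HK] := entire_bounded_on_disc (k%:R + 2) dg.
pose B := Num.bound `|K|.
have KB : K <= B%:R.
  by apply: le_trans (ler_norm _) (ltW (archi_boundP _)); exact: normr_ge0.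
have e4 : 0 < e / 4 by rewrite divr_gt0.
pose m := Num.bound (e / 4)^-1.
have me : m.+1%:R^-1 <= e / 4.
  rewrite -[leRHS]invrK lef_pV2 ?posrE ?invr_gt0 ?ltr0n//.
  apply: le_trans (ltW (archi_boundP _)) _; first by rewrite invr_ge0 ltW.
  by rewrite ler_nat.
have B0 : 0 <= B%:R :> R by rewrite ler0n.
have B1 : 0 < 8 * (B%:R + 1) :> R by lra.
pose del := Num.min 1 (e / (8 * (B%:R + 1))).
have del0 : 0 < del by rewrite lt_min ltr01 divr_gt0.
have del1 : del <= 1 by rewrite ge_min lexx.
have delB : 2 * B%:R * del <= e / 4.
  have : del <= e / (8 * (B%:R + 1)) by rewrite ge_min lexx orbT.
  rewrite ler_pdivlMr// => H.
  have -> : e / 4 = 2 * (e / 8) by field.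
  rewrite -mulrA ler_pM2l ?ltr0n// ler_pdivlMr ?ltr0n//.
  by apply: le_trans H; nra.
(* By compactness finitely many points [x i] form a [del]-net of the disc. *)
have [|G _ /(_ G (leqnn G)) HG] := (compact_near_coveringP (disc rho)).1
   (@compact_disc R rho) nat \oo
   (fun G z => exists2 i, (i < G)%N & normc (z - x i) < del) _.
  move=> z _; have del2 : 0 < del / 2 by rewrite divr_gt0.
  have [i zi] := xP z _ del2.
  exists ([set w | normc (w - z) < del / 2], [set G | (i < G)%N]) => /=.
    split; first by apply/nbhs_complexP; exists (del / 2).
    by exists i.+1.
  case=> w G [/= wz iG]; exists i => //.
  by apply: le_lt_trans (normc_dist_triangle z _ _) _; lra.
have m0 : 0 < m.+1%:R^-1 :> R by rewrite invr_gt0 ltr0n.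
have /choice[vv vvP] i : exists j, normc (g (x i) - x j) < m.+1%:R^-1 := xP _ _ m0.
pose d := (B, k, m, mkseq vv G).
have gfits : fits d g.
  split=> // [z zk|i]; first exact: le_trans (HK z zk) KB.
  by rewrite size_mkseq => iG; rewrite nth_mkseq// ltW.
have [_ /(_ (ex_intro _ g gfits)) [ds sB sv]] := selP d.
exists (pickle d) => z zr; rewrite /p pickleK.
have [i iG zi] := HG z zr.
have zk : normc z <= k%:R + 1 by apply: le_trans zr _; lra.
have xk : normc (x i) <= k%:R + 1.
  have := normcB_le z (z - x i); rewrite (_ : z - (z - x i) = x i); last by ring.
  by move=> H; apply: le_trans H _; lra.
have bd h : (forall z, normc z <= k%:R + 2 -> normc (h z) <= B%:R) ->
    forall z, normc z <= k%:R + 1 + 1 -> normc (h z : R[i]) <= B%:R.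
  by move=> H w wk; apply: H; lra.
have [_ gB _] := gfits.
have L1 := lipschitz_on_disc dg (bd _ gB) zk xk.
have L2 := lipschitz_on_disc ds (bd _ sB) xk zk.
have [iv] : (i < size (mkseq vv G))%N by rewrite size_mkseq.
have := sv i; rewrite size_mkseq => /(_ iG); rewrite nth_mkseq// => S2.
have S1 := ltW (vvP i).
have Z1 : 2 * B%:R * normc (z - x i) <= e / 4.
  by apply: le_trans delB; rewrite ler_wpM2l ?mulr_ge0// ltW.
have Z2 : 2 * B%:R * normc (x i - z) <= e / 4 by rewrite normc_distC.
(* Four errors of [e / 4]: two from the Lipschitz bounds, two from the approximate values at
   [x i]. *)
rewrite (_ : _ - _ = (g z - g (x i)) + (g (x i) - x (vv i)) -
  (sel d (x i) - x (vv i)) + (sel d (x i) - sel d z)); last by ring.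
apply: le_trans (le_normcD _ _) _.
apply: le_trans (lerD (normcB_le _ _) (le_trans L2 Z2)) _.
apply: le_trans (lerD (lerD (le_normcD _ _) (le_trans S2 me)) (lexx _)) _.
have h1 := lerD (le_trans L1 Z1) (le_trans S1 me).
apply: le_trans (lerD (lerD h1 (lexx _)) (lexx _)) _.
lra.
Qed.

(** The bound telescopes, since [e k / 4 <= e k / 2 - e k.+1 / 2]. The tolerances may shrink faster
    than geometrically, and the limit still stays within each of them. *)
Lemma shrinking_limit (u : nat -> R[i]) (e : nat -> R) : (forall k, 0 < e k) ->
    (forall k, e k.+1 <= e k / 2) -> (forall k, normc (u k.+1 - u k) <= e k / 4) ->
  exists l, forall k, normc (u k - l) <= e k.
Proof.
move=> e_gt0 e_half u_step.
have [|l ul] := @geometric_cauchy_limitC R u (e 0 / 4).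
  move=> k; apply: le_trans (u_step k) _.
  by rewrite mulrAC ler_wpM2r// halving_le.
exists l => k.
have near j : normc (u k - u (k + j)%N) <= e k / 2 - e (k + j)%N / 2.
  elim: j => [|j IHj]; first by rewrite addn0 !subrr normc0.
  apply: le_trans (normc_dist_triangle (u (k + j)%N) _ _) _.
  rewrite addnS; have := u_step (k + j)%N; rewrite normc_distC.
  by have := e_half (k + j)%N; lra.
have [j Hj] := geometric_small (4 * (e 0 / 4)) (divr_gt0 (e_gt0 k) (ltr0n R 2)).
apply: le_trans (normc_dist_triangle (u (k + j)%N) _ _) _.
have H : normc (u (k + j)%N - l) <= e k / 2.
  apply: le_trans (ul (k + j)%N) (le_trans _ (ltW Hj)).
  rewrite ler_wpM2l//; first by have := e_gt0 0; lra.
  by rewrite lef_pV2 ?posrE ?exprn_gt0// ler_eXn2l ?leq_addl// ltr1n.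
by have := near j; have := e_gt0 (k + j)%N; lra.
Qed.

(** Baire's argument by hand: each new centre moves by at most a quarter of the tolerance,
    tolerances at least halve and radii grow by at least one, so the centres converge locally
    uniformly to an entire function lying in every chosen neighbourhood. *)
Lemma dense_bigcap_open_entire (F : nat -> set (entire_space R)) :
    (forall j, open (F j)) ->
    (forall j f (rho e : R), 0 < e -> exists2 h, F j h &
       forall z, normc z <= rho -> normc (set_val h z - set_val f z) <= e) ->
  dense (\bigcap_j F j).
Proof.
move=> F_open F_dense U [f0 Uf0] U_open.
have [rho0 [e0 [e0_gt0 sub0]]] : exists rho e, 0 < e /\ forall h : entire_space R,
    (forall z : R[i], normc z <= rho -> normc (set_val h z - set_val f0 z) <= e) -> U h.
  by apply/nbhs_entireP; exact: open_nbhs_nbhs.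
(* A state consists of a function, a radius and a tolerance. Positivity of the tolerance is a
   premise inside the existential, so that choice yields a total successor function. *)
have step j (st : entire_space R * R * R) : exists st' : entire_space R * R * R,
    0 < st.2 -> [/\ 0 < st'.2, st'.2 <= st.2 / 2, st.1.2 + 1 <= st'.1.2,
      forall z, normc z <= st.1.2 ->
        normc (set_val st'.1.1 z - set_val st.1.1 z) <= st.2 / 4 &
      forall h : entire_space R,
        (forall z : R[i], normc z <= st'.1.2 ->
          normc (set_val h z - set_val st'.1.1 z) <= st'.2) ->
        F j h].
  case: st => [[f rho] e] /=; have [e_gt0|] := ltP 0 e; last by exists (f, rho, e).
  have [h Fh hf] := F_dense j f rho _ (divr_gt0 e_gt0 (ltr0n R 4)).
  have [rho' [e' [e'_gt0 sub]]] : exists rho e, 0 < e /\ forall h' : entire_space R,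
      (forall z : R[i], normc z <= rho -> normc (set_val h' z - set_val h z) <= e) ->
      F j h'.
    by apply/nbhs_entireP; apply: open_nbhs_nbhs.
  exists (h, Num.max rho' (rho + 1), Num.min e' (e / 2)) => _ /=; split=> //.
  - by rewrite lt_min e'_gt0 divr_gt0.
  - by rewrite ge_min lexx orbT.
  - by rewrite le_max lexx orbT.
  - move=> h' H; apply: sub => z zr; apply: le_trans (H z _) _.
      by rewrite le_max zr.
    by rewrite ge_min lexx.
have /choice[nxt nxtP] (q : nat * (entire_space R * R * R)) := step q.1 q.2.
pose st := fix st j := if j is j'.+1 then nxt (j', st j') else (f0, rho0, e0).
pose fn j : R[i]^o -> R[i]^o := set_val (st j).1.1.
pose rho j := (st j).1.2; pose e j := (st j).2.
have e_gt0 j : 0 < e j by elim: j => // j IHj; have [] := nxtP (j, st j) IHj.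
have stP j := nxtP (j, st j) (e_gt0 j).
have e_half j : e j.+1 <= e j / 2 by have [] := stP j.
have rho_step j : rho j + 1 <= rho j.+1 by have [] := stP j.
have fn_step j z : normc z <= rho j -> normc (fn j.+1 z - fn j z) <= e j / 4.
  by have [_ _ _ + _] := stP j; apply.
have rho_mono i j : (i <= j)%N -> rho i <= rho j.
  elim: j => [|j IHj]; first by rewrite leqn0 => /eqP ->.
  by rewrite leq_eqVlt => /orP[/eqP ->//|/IHj]; have := rho_step j; lra.
have rho_growth j : rho0 + j%:R <= rho j.
  elim: j => [|j IHj]; first by rewrite addr0.
  have jS : j.+1%:R = j%:R + 1 :> R by rewrite natr1.
  by have := rho_step j; rewrite jS; lra.
have rho_large (t : R) : exists j, t <= rho j.
  exists (Num.bound `|t - rho0|); apply: le_trans (rho_growth _).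
  rewrite -lerBlDl; apply: le_trans (ler_norm _) (ltW (archi_boundP _)).
  exact: normr_ge0.
have /choice[lim limP] z : exists l, forall j, normc z <= rho j ->
    normc (fn j z - l) <= e j.
  (* The values at [z] are controlled only from the first radius reaching [z], so the sequence is
     started there. *)
  have [J zJ Jmin] := ex_minnP (rho_large (normc z)).
  have [|||l lP] := @shrinking_limit (fun k => fn (J + k)%N z) (fun k => e (J + k)%N).
  - by move=> k; exact: e_gt0.
  - by move=> k; rewrite addnS; exact: e_half.
  - move=> k; rewrite addnS; apply: fn_step.
    by apply: le_trans zJ (rho_mono _ _ (leq_addr _ _)).
  by exists l => j /Jmin Jj; rewrite -(subnKC Jj); exact: lP.
have dlim : entire R lim.
  apply: entire_locally_uniform_limit => t eps eps0.
  have [j1 tj1] := rho_large t; have [j2 ej2] := geometric_small e0 eps0.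
  pose j := maxn j1 j2; exists (fn j) => [|z zt]; first exact: (set_valP (st j).1.1).
  rewrite normc_distC; apply: le_trans (limP z j _) _.
    by apply: le_trans zt (le_trans tj1 (rho_mono _ _ (leq_maxl _ _))).
  apply: le_trans (halving_le e_half j) (le_trans _ (ltW ej2)).
  rewrite ler_wpM2l ?(ltW e0_gt0)// lef_pV2 ?posrE ?exprn_gt0//.
  by rewrite ler_eXn2l ?leq_maxr// ltr1n.
exists (of_entire dlim); split.
  by apply: sub0 => z zr; rewrite of_entireE normc_distC; exact: (limP z 0 zr).
move=> j _; have [_ _ _ _] := stP j; apply=> z zr.
by rewrite of_entireE normc_distC; exact: (limP z j.+1 zr).
Qed.

(** * Functions hitting a target in every direction *)

Variables (lambda : nat -> R[i]) (r : R).

Definition hits p (k s : R) f := forall a, normc a = r ->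
  exists n, forall z, normc z <= k -> normc (set_val f (z + lambda n * a) - p z) <= s.

(** One tolerance [s], strictly below the precision, serves all directions; this slack makes the set
    open although [hits] uses weak inequalities. *)
Definition hits_within p (m : nat) : set (entire_space R) :=
  [set f | exists2 s, s < m.+1%:R^-1 & hits p m%:R s f].

Lemma compact_circle : compact (circle r : set R[i]^o).
Proof.
apply: subclosed_compact (@compact_disc R r) _; last by move=> z; rewrite /disc /= => ->.
rewrite closedE => z nz; apply/eqP/negPn/negP => zr; apply: nz.
have d0 : 0 < `|normc z - r| by rewrite normr_gt0 subr_eq0.
apply/nbhs_complexP; exists `|normc z - r| => // w wz /= wr.
have := le_normcD z (w - z); rewrite (_ : z + (w - z) = w); last by ring.
have := normcB_le w (w - z); rewrite (_ : w - (w - z) = z); last by ring.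
move: wz; rewrite wr; case: (ler0P (normc z - r)); lra.
Qed.

(** An index good for [a] remains good for nearby directions at a slightly larger tolerance, so
    compactness of the circle leaves finitely many indices. *)
Lemma hits_uniform p (k s s' : R) f : s < s' -> hits p k s f ->
  exists G, forall a, normc a = r -> exists2 n, (n < G)%N &
    forall z, normc z <= k -> normc (set_val f (z + lambda n * a) - p z) <= s'.
Proof.
move=> ss' hf.
have [|G _ /(_ G (leqnn G)) HG] := (compact_near_coveringP _).1 compact_circle nat \oo
   (fun G a => exists2 n, (n < G)%N & forall z, normc z <= k ->
      normc (set_val f (z + lambda n * a) - p z) <= s') _; last by exists G => a /HG.
move=> a na; have [n Hn] := hf a na; have r0 : 0 <= r by rewrite -na normc_ge0.
have [K K0 Kf] := entire_lipschitz (k + normc (lambda n) * (r + 1)) (set_valP f).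
have l0 := normc_ge0 (lambda n).
have q0 : 0 < K * normc (lambda n) + 1 by rewrite ltr_wpDl ?ltr01// mulr_ge0// ltW.
have d0 : 0 < Num.min 1 ((s' - s) / (K * normc (lambda n) + 1)).
  by rewrite lt_min ltr01 divr_gt0// subr_gt0.
exists ([set b | normc (b - a) < Num.min 1 ((s' - s) / (K * normc (lambda n) + 1))],
  [set G | (n < G)%N]) => /=.
  by split; [apply/nbhs_complexP; eexists; [exact: d0|]|exists n.+1].
case=> b G [/= + nG]; rewrite lt_min => /andP[b1 bs]; exists n => // z zk.
rewrite ltr_pdivlMr// in bs.
have nb : normc b <= r + 1.
  have := le_normcD a (b - a); rewrite (_ : a + (b - a) = b); last by ring.
  by rewrite na; lra.
have in_disc c : normc c <= r + 1 ->
    normc (z + lambda n * c) <= k + normc (lambda n) * (r + 1).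
  move=> nc; apply: le_trans (le_normcD _ _) _; rewrite normcM lerD//.
  by rewrite ler_wpM2l.
have na1 : normc a <= r + 1 by rewrite na lerDl.
have := Kf _ _ (in_disc b nb) (in_disc a na1).
rewrite (_ : z + lambda n * b - _ = lambda n * (b - a)); last by ring.
rewrite normcM => h1; have h2 := Hn z zk; have ba0 := normc_ge0 (b - a).
apply: le_trans (normc_dist_triangle (set_val f (z + lambda n * a)) _ _) _.
by nra.
Qed.

(** Since finitely many indices suffice, all translates involved live on one disc, and closeness on
    that disc preserves the property. *)
Lemma open_hits_within p m : 0 <= r -> open (hits_within p m).
Proof.
move=> r0; rewrite openE => f [s sm hf]; apply/nbhs_entireP.
(* Between [s] and the precision, [s'] absorbs the compactness argument and [t] the perturbation of
   [f]. *)
have [t st tm] : exists2 t, s < t & t < m.+1%:R^-1.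
  by exists ((s + m.+1%:R^-1) / 2); rewrite ?midf_lt.
pose s' := (s + t) / 2.
have ss' : s < s' by rewrite /s' midf_lt.
have s't : s' < t by rewrite /s' midf_lt.
have [G HG] := hits_uniform ss' hf.
exists (m%:R + (\sum_(n < G) normc (lambda n)) * r), (t - s').
split; first by rewrite subr_gt0.
move=> h hfclose; exists t => //.
move=> a na; have [n nG Hn] := HG a na; exists n => z zm.
apply: le_trans (normc_dist_triangle (set_val f (z + lambda n * a)) _ _) _.
have := Hn z zm; have := hfclose (z + lambda n * a).
have -> : normc (z + lambda n * a) <= m%:R + (\sum_(n < G) normc (lambda n)) * r.
  apply: le_trans (le_normcD _ _) _; rewrite normcM na lerD// ler_wpM2r//.
  by rewrite (bigD1 (Ordinal nG))//= lerDl sumr_ge0// => i _; exact: normc_ge0.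
by move=> /(_ isT); lra.
Qed.

(** The quantifiers over directions and over targets commute, and the targets can be restricted to
    the dense sequence with radius [m] and precision [m.+1%:R^-1]. Thus the uncountable intersection
    becomes countable; numbers that code no pair give [setT]. *)
Lemma bigcap_HC_hits (p : nat -> R[i]^o -> R[i]^o) : (forall i, entire R (p i)) ->
    (forall g (rho e : R), entire R g -> 0 < e ->
      exists i, forall z, normc z <= rho -> normc (g z - p i z) <= e) ->
  \bigcap_(a in circle r) HC (fun n => translation (lambda n * a)) =
  \bigcap_(j in [set: nat])
    (if unpickle j is Some (i, m) then hits_within (p i) m else setT).
Proof.
move=> dp p_dense; apply/seteqP; split=> f Hf.
  move=> j _; case: (unpickle j) => [[i m]|//].
  have m0 : 0 < m.+1%:R^-1 :> R by rewrite invr_gt0 ltr0n.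
  exists (m.+1%:R^-1 / 2); first by rewrite ltr_pdivrMr ?ltr0n// ltr_pMr// ltr1n.
  move=> a na; have Hfa : dense _ := Hf a na.
  pose U : set (entire_space R) := [set h | forall z : R[i], normc z <= m%:R ->
    normc (set_val h z - set_val (of_entire (dp i)) z) <= m.+1%:R^-1 / 2].
  have nU : nbhs (of_entire (dp i)) U.
    by apply/nbhs_entireP; exists m%:R, (m.+1%:R^-1 / 2); split=> //; rewrite divr_gt0.
  have := Hfa (interior U); case.
  - by exists (of_entire (dp i)).
  - exact: open_interior.
  move=> h [/interior_subset Uh [n _ hE]]; exists n => z zm.
  by move: Uh; rewrite -hE => /(_ z zm).
move=> a na U [g Ug] U_open.
have [rho [e [e0 sub]]] : exists rho e, 0 < e /\ forall h : entire_space R,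
    (forall z : R[i], normc z <= rho -> normc (set_val h z - set_val g z) <= e) -> U h.
  by apply/nbhs_entireP; exact: open_nbhs_nbhs.
have e2 : 0 < e / 2 by rewrite divr_gt0.
have [i gi] := p_dense _ rho _ (set_valP g) e2.
(* A single [m] serves both as a radius beyond [rho] and as a precision below [e / 2]. *)
pose m := maxn (Num.bound `|rho|) (Num.bound (e / 2)^-1).
have rhom : rho <= m%:R.
  apply: le_trans (ler_norm _) _; apply: le_trans (ltW (archi_boundP (normr_ge0 _))) _.
  by rewrite ler_nat leq_maxl.
have me : m.+1%:R^-1 <= e / 2.
  rewrite -[leRHS]invrK lef_pV2 ?posrE ?invr_gt0 ?ltr0n//.
  apply: le_trans (ltW (archi_boundP _)) _; first by rewrite invr_ge0 ltW.
  by rewrite ler_nat leqW// leq_maxr.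
have := Hf (pickle (i, m)) I; rewrite pickleK => -[s sm /(_ a na)[n Hn]].
exists (translation (lambda n * a) f); split; last by exists n.
apply: sub => z zr; rewrite translationE.
apply: le_trans (normc_dist_triangle (p i z) _ _) _.
rewrite [normc (p i z - _)]normc_distC.
have {sm} se := ltW (lt_le_trans sm me).
by rewrite [e]splitr lerD// ?gi// (le_trans _ se)// Hn// (le_trans zr).
Qed.

End Hypercyclic.

(** * Common hypercyclic functions for all directions on the circle *)

Theorem theorem1p2 (R : realType) (lambda : nat -> R[i])
  (lambda_neq0 : forall n, lambda n != 0)
  (lambda_cvg : (fun n => normc (lambda n)) @ \oo --> +oo)
  (lambda_sub : forall M : R, 0 < M ->
    exists (phi : nat -> nat) (mu : nat -> R[i]),
      [/\ {homo phi : m n / (m < n)%N},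
          mu = lambda \o phi,
          forall n, M < normc (mu n.+1) - normc (mu n) &
          limn_esup (fun n => (normc (mu n))%:E *
            \sum_(n <= k <oo) ((normc (mu k))^-1)%:E)%E = +oo%E])
  (r : R) (r_gt0 : 0 < r) :
  [/\ Gdelta (\bigcap_(a in circle r) HC (fun n => translation (lambda n * a))),
      dense (\bigcap_(a in circle r) HC (fun n => translation (lambda n * a))) &
      \bigcap_(a in circle r) HC (fun n => translation (lambda n * a)) !=set0].
Proof.
have [p [dp p_dense]] := dense_sequence_entire R.
pose F j := if unpickle j is Some (i, m) then hits_within lambda r (p i) m else setT.
have HCE : \bigcap_(a in circle r) HC (fun n => translation (lambda n * a)) =
  \bigcap_j F j := bigcap_HC_hits lambda r dp p_dense.
have F_open j : open (F j).
  rewrite /F; case: (unpickle j) => [[i m]|]; last exact: openT.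
  exact: open_hits_within (ltW r_gt0).
have F_dense : dense (\bigcap_j F j).
  apply: dense_bigcap_open_entire F_open _ => j f rho e e0.
  rewrite /F; case: (unpickle j) => [[i m]|]; last first.
    by exists f => // z _; rewrite subrr normc0 ltW.
  have m_gt0 : 0 < m.+1%:R^-1 :> R by rewrite invr_gt0 ltr0n.
  have m0 : 0 < m.+1%:R^-1 / 2 :> R by rewrite divr_gt0.
  (* Half the precision leaves the strict inequality required by [hits_within]; [e] keeps the new
     function close to [f]. *)
  have eps0 : 0 < Num.min e (m.+1%:R^-1 / 2) by rewrite lt_min e0.
  have [g [dg gf ghit]] :=
    circle_approximation lambda_sub rho m%:R r_gt0 (set_valP f) (dp i) eps0.
  exists (of_entire dg).
    exists (m.+1%:R^-1 / 2); first by rewrite ltr_pdivrMr ?ltr0n// ltr_pMr// ltr1n.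
    move=> a /ghit[n Hn]; exists n => z /Hn H; apply: le_trans H _.
    by rewrite ge_min lexx orbT.
  by move=> z /gf H; apply: le_trans H _; rewrite ge_min lexx.
rewrite HCE; split=> //; first by exists F.
have [|h [_ Fh]] := F_dense setT _ openT; last by exists h.
by exists (of_entire (entire_cst 0)).
Qed.
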